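(* Assume $E[\omega(0)]<\infty$. Then there exists a constant $0<\alpha<1$ such that for all $\epsilon>0$, \[ \limsup_{\|x\|_1 \to \infty} \frac{1}{\|x\|_1^{\alpha}} \log \bar{P}\bigl(T(0,x) \leq (1-\epsilon)\mu(x)\bigr)<0, \] where the limit superior is over $x\in\mathbb{Z}^d$.
   Context: Let $d \geq 2$. Let $\omega=(\omega(x))_{x \in \mathbb{Z}^d}$ be independent random variables with a common law on $\mathbb{N}_0=\{0,1,2,\dots\}$, not concentrated at $0$. Independently of $\omega$, let $(S_k(x,\ell))_{k \geq 0}$, $x \in \mathbb{Z}^d$, $\ell \in \mathbb{N}$, be independent simple random walks on $\mathbb{Z}^d$ with $S_0(x,\ell)=x$. For $x,y \in \mathbb{Z}^d$ let $\tau(x,y):=\inf\{k \geq 0: S_k(x,\ell)=y \text{ for some } 1 \leq \ell \leq \omega(x)\}$, with $\tau(x,y):=\infty$ if $\omega(x)=0$, and define the first passage time $T(x,y):=\inf\{\sum_{i=0}^{m-1}\tau(x_i,x_{i+1}): m \geq 1,\ x=x_0,x_1,\dots,x_m=y \in \mathbb{Z}^d\}$. Write $\bar{P}:=P(\cdot \mid \omega(0) \geq 1)$ and $\|\cdot\|_1$ for the $\ell^1$-norm. The time constant $\mu(\cdot)$ is the (deterministic) norm on $\mathbb{R}^d$ such that almost surely on $\{\omega(0)\ge 1\}$, $\lim_{\|x\|_1\to\infty}(T(0,x)-\mu(x))/\|x\|_1=0$ (its existence is known). *)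

(* Defs.v *)
From HB Require Import structures.
From mathcomp Require Import all_boot all_order all_algebra.
From mathcomp Require Import all_classical all_reals all_analysis.
Set Implicit Arguments. Unset Strict Implicit. Unset Printing Implicit Defensive.
Import Order.TTheory GRing.Theory Num.Theory.
Import numFieldNormedType.Exports.
Local Open Scope classical_set_scope.
Local Open Scope ring_scope.

Notation lat d := 'rV[int]_d.

Section Defs.
Variable R : realType.
Variable d : nat.

Definition norm1 (x : lat d) : R := \sum_(i < d) (`|x 0 i| : int)%:~R.

Definition vR (x : lat d) : 'rV[R]_d := map_mx (fun z : int => z%:~R) x.

Definition is_norm (mu : 'rV[R]_d -> R) : Prop :=
  [/\ forall v, 0 <= mu v,
      forall v, mu v = 0 -> v = 0,
      forall (a : R) v, mu (a *: v) = `|a| * mu v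
    & forall v w, mu (v + w) <= mu v + mu w].

Variables (dm : measure_display) (Om : measurableType dm).

Definition pr (P : set Om -> \bar R) (A : set Om) : R := fine (P A).

Definition cond_pr (P : set Om -> \bar R) (B A : set Om) : R :=
  pr P (A `&` B) / pr P B.

Definition mutually_indep_discrete (I : eqType) (V : Type)
  (P : set Om -> \bar R) (X : I -> Om -> V) : Prop :=
  forall (F : seq I), uniq F -> forall a : I -> V,
    pr P (\bigcap_(i in [set` F]) [set w | X i w = a i])
    = \prod_(i <- F) pr P [set w | X i w = a i].

(* tau(x,y): first time one of the omega(x) walks started at x hits y
   (walk number l+1 of the paper is S x l here, so 1 <= l+1 <= omega(x)
   becomes l < omega(x)); +oo if there is none (in particular if
   omega(x) = 0) *)
Definition tau (om : lat d -> Om -> nat) (S : lat d -> nat -> nat -> Om -> lat d)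
  (x y : lat d) (w : Om) : \bar R :=
  ereal_inf [set ((k%:R)%:E : \bar R) | k in
             [set k : nat | exists l : nat, (l < om x w)%N /\ S x l k w = y]].

Definition fpt (om : lat d -> Om -> nat) (S : lat d -> nat -> nat -> Om -> lat d)
  (x y : lat d) (w : Om) : \bar R :=
  ereal_inf [set (\sum_(ab <- zip (x :: p) p) tau om S ab.1 ab.2 w)%E | p in
             [set p : seq (lat d) | p != [::] /\ last x p = y]].

Definition elog (p : R) : \bar R := if p == 0 then -oo%E else (ln p)%:E.

(* limsup_{||x||_1 -> oo} f x := lim_N sup_{||x||_1 >= N} f x
   (= inf over N since the sups decrease) *)
Definition limsup_norm1 (f : lat d -> \bar R) : \bar R :=
  ereal_inf [set ereal_sup [set f x | x in [set x | (N%:R : R) <= norm1 x]]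
            | N in [set: nat]].

End Defs.

(* Main.v *)
Require Import Defs.
From HB Require Import structures.
From mathcomp Require Import all_boot all_order all_algebra.
From mathcomp Require Import all_classical all_reals all_analysis.
From mathcomp Require Import measurable_realfun.
From mathcomp Require Import zify ring lra.
Import Order.TTheory GRing.Theory Num.Theory.
Import numFieldNormedType.Exports.
Local Open Scope classical_set_scope.
Local Open Scope ring_scope.
Set Implicit Arguments. Unset Strict Implicit. Unset Printing Implicit Defensive.

(* Let [n = |x|], [m = n^(1/3)], [h = m^2] and cut Z^d into cells of
   side [h].

   A cell is fast if from some site close to it a site at distance of order [H h]
   is reached before a fraction [1 - eps/2] of the time predicted by [mu]. An
   occupied source [p] at distance of order [h] from the cell satisfies
   [T(p,z) <= T(p,y) + T(y,z)], so a fast cell forces every such source to be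
   vacant or atypical; hence the probability that a cell is fast tends to 0 as
   [h] tends to infinity. No rate is needed. Whether a cell is fast depends only on frogs at
   distance [O(h)], so far apart cells are independent.

   If [T(0,x) <= (1 - eps) mu(x)], cut an optimal chain at its last exits from
   balls of radius [H h]. Unless a frog moves a distance [h] within time [O(n)],
   which by a Chernoff bound and [E omega(0) < oo] has probability
   [O(exp(-c m))] up to polynomial factors, the cells met at these exits form a
   self-avoiding path with bounded steps and at most [O(n / h) = O(m)] cells. By
   subadditivity of [mu] at least [c m] of them are fast. The number of such paths
   is exponential in [m], and a fast cell is as unlikely as we like, so the union
   bound gives [exp(-c m)], that is, [alpha = 1/3]. *)

(** The exponent balances two costs: a displacement [h] within time of order [n] has probability
    about [exp(-c h^2/n)], and a positive fraction of fast cells among [n/h] has probability about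
    [exp(-c n/h)]. Both exponents are of order [m] exactly when [h = n^(2/3)]. The convergence to
    [mu] is qualitative and concerns the origin only. A union over the sites of a cell, whose number
    grows with [h], would need a rate. So a cell is tested from a number of sources fixed before
    [h]: one occupied, typical source controls all pairs [(y, z)] at once. The entropy of cell paths
    per unit of [m] does not depend on [h]; the target probability of a fast cell is chosen after
    this entropy, and [h] last. The product bound over cells needs exact locality. Passages are
    therefore required to have speed at most one in every configuration, which costs only a null
    set. Only the law of finitely many discrete coordinates is given, so events live on a
    configuration space, where measurability, independence and translation invariance all reduce to
    cylinders. *)

(** * Events that depend on a given set of coordinates *)

Section CylinderAlgebra.
Variables (I V : choiceType).
Implicit Types (J : set I) (A B : set (I -> V)) (s : seq (I * V)).

(** A list may prescribe two values at one index, and the cylinder is then empty. Allowing this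
    makes concatenation of lists correspond to intersection, so cylinders form a pi-system. *)
Definition cyl s : set (I -> V) :=
  [set eta | forall p, p \in s -> eta p.1 = p.2].

Definition cyls J : set (set (I -> V)) :=
  [set A | exists2 s, A = cyl s & forall p, p \in s -> J p.1].

Definition csig J : set (set (I -> V)) := <<s cyls J >>.

Lemma cyl_cat s1 s2 : cyl (s1 ++ s2) = cyl s1 `&` cyl s2.
Proof.
apply/seteqP; split=> eta /=.
  by move=> h; split=> p ps; apply: h; rewrite mem_cat ps ?orbT.
by case=> h1 h2 p; rewrite mem_cat => /orP[/h1|/h2].
Qed.

Lemma cyls_setI J : setI_closed (cyls J).
Proof.
move=> _ _ [s1 -> h1] [s2 -> h2]; exists (s1 ++ s2); first by rewrite cyl_cat.
by move=> p; rewrite mem_cat => /orP[/h1|/h2].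
Qed.

Lemma sigC J A : csig J A -> csig J (~` A).
Proof. by move=> h; rewrite -setTD; exact: sigma_algebraCD. Qed.

Lemma sig0 J : csig J set0. Proof. exact: sigma_algebra0. Qed.

Lemma sigT J : csig J setT. Proof. by rewrite -setC0; apply: sigC; exact: sig0. Qed.

Lemma sig_bigcup (U : countType) J (F : U -> set (I -> V)) :
  (forall u, csig J (F u)) -> csig J (\bigcup_u F u).
Proof.
move=> h.
have -> : \bigcup_u F u = \bigcup_n (odflt set0 (omap F (unpickle n))).
  apply/seteqP; split=> eta [u _ Fu].
    by exists (pickle u) => //; rewrite pickleK.
  by move: Fu; case: (unpickle u) => //= u' Fu; exists u'.
apply: sigma_algebra_bigcup => n; case: (unpickle n) => [u|] //=.
  exact: h.
exact: sig0.
Qed.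

Lemma sig_bigcap (U : countType) J (F : U -> set (I -> V)) :
  (forall u, csig J (F u)) -> csig J (\bigcap_u F u).
Proof.
move=> h; rewrite -[X in csig J X]setCK; apply: sigC; rewrite setC_bigcap.
by apply: sig_bigcup => u; exact: sigC.
Qed.

Lemma sigI J A B : csig J A -> csig J B -> csig J (A `&` B).
Proof.
move=> hA hB; have -> : A `&` B = \bigcap_(b : bool) (if b then A else B).
  apply/seteqP; split=> eta /=; first by case=> ? ? [].
  by move=> h; split; [exact: (h true)|exact: (h false)].
by apply: sig_bigcap => -[].
Qed.

Lemma sigU J A B : csig J A -> csig J B -> csig J (A `|` B).
Proof.
move=> hA hB; rewrite -[_ `|` _]setCK setCU.
by apply: sigC; apply: sigI; exact: sigC.
Qed.

Lemma sig_cst J (Q : Prop) : csig J [set _ | Q].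
Proof.
have [h|h] := pselect Q.
  have -> : [set _ : I -> V | Q] = setT by apply/seteqP; split.
  exact: sigT.
have -> : [set _ : I -> V | Q] = set0 by apply/seteqP; split.
exact: sig0.
Qed.

Lemma sig_ex (U : countType) J (F : U -> (I -> V) -> Prop) :
  (forall u, csig J [set eta | F u eta]) -> csig J [set eta | exists u, F u eta].
Proof.
move=> h; have -> : [set eta | exists u, F u eta] = \bigcup_u [set eta | F u eta].
  by apply/seteqP; split=> eta [u] //; exists u.
exact: sig_bigcup.
Qed.

Lemma sig_all (U : countType) J (F : U -> (I -> V) -> Prop) :
  (forall u, csig J [set eta | F u eta]) -> csig J [set eta | forall u, F u eta].
Proof.
move=> h; have -> : [set eta | forall u, F u eta] = \bigcap_u [set eta | F u eta].
  by apply/seteqP; split=> eta /= H u; [move=> _|]; apply: H.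
exact: sig_bigcap.
Qed.

(** A deterministic side condition may be assumed while measurability is checked. This is how a
    bound on a passage time becomes a bound on the coordinates involved. *)
Lemma sig_guard (Q : Prop) J A :
  (Q -> csig J A) -> csig J [set eta | Q /\ A eta].
Proof.
move=> h; have [q|q] := pselect Q.
  have -> : [set eta | Q /\ A eta] = A by apply/seteqP; split=> [eta []|].
  exact: h.
have -> : [set eta | Q /\ A eta] = set0 by apply/seteqP; split=> [eta []|].
exact: sig0.
Qed.

Lemma sig_mono J1 J2 : J1 `<=` J2 -> csig J1 `<=` csig J2.
Proof.
move=> h; apply: sub_sigma_algebra2 => _ [s -> hs]; exists s => // p /hs.
exact: h.
Qed.

Lemma sigW J1 J2 A : (forall i, J1 i -> J2 i) -> csig J1 A -> csig J2 A.
Proof. by move=> h; exact: (sig_mono h). Qed.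

Lemma sig_cyl J s : (forall p, p \in s -> J p.1) -> csig J (cyl s).
Proof. by move=> h; apply: sub_sigma_algebra; exists s. Qed.

Lemma sig_eq J i v : J i -> csig J [set eta | eta i = v].
Proof.
move=> Ji; have -> : [set eta | eta i = v] = cyl [:: (i, v)].
  apply/seteqP; split=> eta /=; last by move=> h; apply: (h (i, v)); rewrite inE.
  by move=> h p; rewrite inE => /eqP ->.
by apply: sig_cyl => p; rewrite inE => /eqP ->.
Qed.

(** Dynkin's pi-lambda theorem as an induction principle. Membership in [csig J] is carried along
    because the complement and union steps of its applications need measurable sets. *)
Lemma sig_ind J (Q : set (I -> V) -> Prop) :
  (forall s, (forall p, p \in s -> J p.1) -> Q (cyl s)) ->
  (forall A, csig J A -> Q A -> Q (~` A)) ->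
  (forall F : nat -> set (I -> V), (forall n, csig J (F n)) ->
     trivIset setT F -> (forall n, Q (F n)) -> Q (\bigcup_n F n)) ->
  forall A, csig J A -> Q A.
Proof.
move=> Qcyl QC QU A; rewrite /csig -(setI_closed_g_dynkin_g_sigma_algebra (@cyls_setI J)).
move=> /(_ [set B | csig J B /\ Q B]) /=; case => //; split.
  split.
  - split; first exact: sigT.
    have -> : [set: I -> V] = cyl [::] by apply/seteqP; split.
    exact: Qcyl.
  - by move=> B [sB QB]; split; [exact: sigC | exact: QC].
  - move=> F tF hF; split; first by apply: sig_bigcup => n; case: (hF n).
    by apply: QU => // n; case: (hF n).
by move=> _ [s -> hs]; split; [exact: sig_cyl | exact: Qcyl].
Qed.

End CylinderAlgebra.

(** * Probabilities of these events; independence over disjoint coordinates *)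

Section Law.
Context (R : realType) (I V : choiceType) (dm : measure_display)
  (Om : measurableType dm) (P : probability Om R).
Implicit Types (Y : Om -> I -> V) (A B : set (I -> V)).

Definition measY Y := forall i v, measurable [set w | Y w i = v].

Definition law Y A : R := fine (P (Y @^-1` A)).

Lemma measurable_sig Y J A : measY Y -> csig J A -> measurable (Y @^-1` A).
Proof.
move=> mY; move: A; apply: sig_ind.
- move=> s hs; have -> : Y @^-1` cyl s = \big[setI/setT]_(p <- s) [set w | Y w p.1 = p.2].
    rewrite -bigcap_seq; apply/seteqP; split=> w /= h p ps; exact: h.
  by apply: bigsetI_measurable => p _; exact: mY.
- by move=> A _ mA; rewrite preimage_setC; exact: measurableC.
- by move=> F _ _ mF; rewrite preimage_bigcup; exact: bigcup_measurable.
Qed.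

Lemma lawE Y J A : measY Y -> csig J A -> P (Y @^-1` A) = (law Y A)%:E.
Proof.
by move=> mY sA; rewrite fineK//; apply: fin_num_measure; exact: measurable_sig sA.
Qed.

Section OneFamily.
Variable Y : Om -> I -> V.
Hypothesis mY : measY Y.
Local Notation sg := (@csig I V setT).

Lemma law_ge0 A : 0 <= law Y A. Proof. by rewrite fine_ge0. Qed.

Lemma law_mono A B : sg A -> sg B -> A `<=` B -> law Y A <= law Y B.
Proof.
move=> sA sB AB; rewrite -lee_fin -(lawE mY sA) -(lawE mY sB) le_measure ?inE//.
- exact: measurable_sig sA.
- exact: measurable_sig sB.
- by move=> w; exact: AB.
Qed.

Lemma lawT : law Y setT = 1.
Proof. by rewrite /law preimage_setT probability_setT. Qed.

Lemma law0 : law Y set0 = 0.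
Proof. by rewrite /law preimage_set0 measure0. Qed.

Lemma law_le1 A : sg A -> law Y A <= 1.
Proof. by move=> sA; rewrite -lawT; apply: law_mono => //; exact: sigT. Qed.

Lemma lawC A : sg A -> law Y (~` A) = 1 - law Y A.
Proof.
move=> sA; apply: EFin_inj; rewrite -(lawE mY (sigC sA)) preimage_setC.
by rewrite probability_setC ?EFinB ?(lawE mY sA)//; exact: measurable_sig sA.
Qed.

Lemma lawU A B : sg A -> sg B -> law Y (A `|` B) <= law Y A + law Y B.
Proof.
move=> sA sB; rewrite -lee_fin EFinD -(lawE mY sA) -(lawE mY sB).
rewrite -(lawE mY (sigU sA sB)) preimage_setU measureU2//.
- exact: measurable_sig sA.
- exact: measurable_sig sB.
Qed.

Lemma law_disjU A B : sg A -> sg B -> A `&` B = set0 ->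
  law Y (A `|` B) = law Y A + law Y B.
Proof.
move=> sA sB AB; apply: EFin_inj; rewrite EFinD -(lawE mY sA) -(lawE mY sB).
rewrite -(lawE mY (sigU sA sB)) preimage_setU measureU//.
- exact: measurable_sig sA.
- exact: measurable_sig sB.
- by rewrite -preimage_setI AB preimage_set0.
Qed.

Lemma law_sigma (F : nat -> set (I -> V)) :
  (forall n, sg (F n)) -> trivIset setT F ->
  (fun n => \sum_(i < n) law Y (F i)) @ \oo --> law Y (\bigcup_n F n).
Proof.
move=> sF tF; have sU := sig_bigcup sF.
have -> : (fun n => \sum_(i < n) law Y (F i)) =
    fine \o (fun n => (\sum_(0 <= i < n) P (Y @^-1` F i))%E).
  apply/funext => n /=; rewrite big_mkord.
  by under [in RHS]eq_bigr do rewrite (lawE mY (sF _)); rewrite sumEFin.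
apply: fine_cvg; rewrite -(lawE mY sU) preimage_bigcup.
apply: measure_semi_sigma_additive.
- by move=> n; exact: measurable_sig (sF n).
- apply/trivIsetP => i j _ _ ij; rewrite -preimage_setI.
  by move/trivIsetP : tF => /(_ _ _ _ _ ij) ->//; rewrite preimage_set0.
- by apply: bigcup_measurable => n _; exact: measurable_sig (sF n).
Qed.

Lemma law_bigcup_le (F : nat -> set (I -> V)) (M : R) :
  (forall n, sg (F n)) -> (forall n, \sum_(i < n) law Y (F i) <= M) ->
  law Y (\bigcup_n F n) <= M.
Proof.
move=> sF hM; have sU := sig_bigcup sF.
rewrite -lee_fin -(lawE mY sU) preimage_bigcup.
apply: (le_trans (generalized_Boole_inequality _ _ _)).
- by move=> n; exact: measurable_sig (sF n).
- by apply: bigcup_measurable => n _; exact: measurable_sig (sF n).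
apply: lime_le; first by apply: is_cvg_nneseries.
apply: nearW => n; rewrite big_mkord.
rewrite (eq_bigr (fun i : 'I_n => (law Y (F i))%:E)) ?sumEFin ?lee_fin ?hM//.
by move=> i _; exact: (lawE mY (sF _)).
Qed.

Lemma law_bigcap_cvg0 (F : nat -> set (I -> V)) :
  (forall n, sg (F n)) -> (forall n m, (n <= m)%N -> F m `<=` F n) ->
  law Y (\bigcap_n F n) = 0 ->
  forall delta, 0 < delta -> exists N, forall n, (N <= n)%N -> law Y (F n) <= delta.
Proof.
move=> sF dF F0 delta d0; have sI := sig_bigcap sF.
have /fine_cvg : (P \o (fun n => Y @^-1` F n)) @ \oo --> (0%R)%:E.
  rewrite -F0 -(lawE mY sI) preimage_bigcap; apply: nonincreasing_cvg_mu.
  - by rewrite [X in (X < _)%E](lawE mY (sF 0%N)) ltry.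
  - by move=> n; exact: measurable_sig (sF n).
  - by apply: bigcap_measurable => // n _; exact: measurable_sig (sF n).
  - by move=> n m nm; apply/subsetPset => w; exact: dF.
move=> /cvgrPdist_le /(_ _ d0) [N _ hN]; exists N => n Nn.
by have := hN n Nn; rewrite sub0r normrN ger0_norm ?fine_ge0.
Qed.

Lemma law_bigU (T : Type) (s : seq T) (F : T -> set (I -> V)) :
  (forall t, sg (F t)) ->
  law Y (\big[setU/set0]_(t <- s) F t) <= \sum_(t <- s) law Y (F t).
Proof.
move=> sF; elim: s => [|t s IH]; first by rewrite !big_nil law0.
have sU : sg (\big[setU/set0]_(t <- s) F t).
  clear IH; elim: s => [|t' s IH].
    by rewrite big_nil; exact: sig0.
  by rewrite big_cons; apply: sigU.
by rewrite !big_cons; apply: (le_trans (lawU (sF t) sU)); rewrite lerD2l.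
Qed.

Lemma law_ex_le (T : choiceType) (s : seq T) (F : T -> (I -> V) -> Prop) A (M : R) :
  sg A -> (forall t, sg [set eta | F t eta]) ->
  (forall t, t \in s -> law Y [set eta | F t eta] <= M) ->
  (forall eta, A eta -> exists2 t, t \in s & F t eta) ->
  law Y A <= (size s)%:R * M.
Proof.
move=> sA sF hM hA.
have sU : sg (\big[setU/set0]_(t <- s) [set eta | F t eta]).
  elim: s {hM hA} => [|t' s IH].
    by rewrite big_nil; exact: sig0.
  by rewrite big_cons; apply: sigU.
have AU : A `<=` \big[setU/set0]_(t <- s) [set eta | F t eta].
  by move=> eta /hA[t ts Ft]; rewrite -bigcup_seq; exists t.
apply: le_trans (law_mono sA sU AU) _.
apply: le_trans (law_bigU _ sF) _.
elim: s hM {hA sU AU} => [|t s IH] hM; first by rewrite big_nil mul0r.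
rewrite big_cons -[(size _)%:R]/((size s).+1%:R) -add1n natrD mulrDl mul1r.
rewrite lerD ?hM ?mem_head// IH// => u us; apply: hM.
by rewrite inE us orbT.
Qed.

End OneFamily.

Lemma law_eq Y1 Y2 : measY Y1 -> measY Y2 ->
  (forall s, law Y1 (cyl s) = law Y2 (cyl s)) ->
  forall A, csig setT A -> law Y1 A = law Y2 A.
Proof.
move=> m1 m2 h; apply: sig_ind; first by move=> s _; exact: h.
- by move=> A sA hA; rewrite !lawC ?hA.
- move=> F sF tF hF; have c1 := law_sigma m1 sF tF.
  have c2 := law_sigma m2 sF tF.
  have E : (fun n => \sum_(i < n) law Y1 (F i)) = (fun n => \sum_(i < n) law Y2 (F i)).
    by apply/funext => n; apply: eq_bigr => i _; exact: hF.
  rewrite E in c1.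
  exact: etrans (esym (cvg_lim (@Rhausdorff R) c1)) (cvg_lim (@Rhausdorff R) c2).
Qed.

Section Independence.
Variable Y : Om -> I -> V.
Hypothesis mY : measY Y.
Implicit Types J : set I.

Definition cyl_indep := forall s1 s2, (forall p q, p \in s1 -> q \in s2 -> p.1 != q.1) ->
  law Y (cyl s1 `&` cyl s2) = law Y (cyl s1) * law Y (cyl s2).

Hypothesis Yindep : cyl_indep.

(** Dynkin's argument runs twice: in the first event against a fixed cylinder over [J2], then in the
    second event against the fixed set [A]. *)
Lemma law_indep J1 J2 A B : J1 `&` J2 = set0 -> csig J1 A -> csig J2 B ->
  law Y (A `&` B) = law Y A * law Y B.
Proof.
have sT J (C : set (I -> V)) : csig J C -> csig setT C by apply: (@sig_mono I V J setT).
have stepC C D : csig setT C -> csig setT D -> law Y (C `&` D) = law Y C * law Y D ->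
    law Y (~` C `&` D) = law Y (~` C) * law Y D.
  move=> sC sD h; rewrite lawC// mulrBl mul1r -h.
  have sCD := sigI sC sD; have sCD' := sigI (sigC sC) sD.
  apply/eqP; rewrite eq_sym subr_eq addrC -law_disjU//.
    by rewrite -setIUl setUv setTI.
  by rewrite setIACA setICr set0I.
have stepU D (F : nat -> set (I -> V)) : csig setT D -> (forall n, csig setT (F n)) ->
    trivIset setT F -> (forall n, law Y (F n `&` D) = law Y (F n) * law Y D) ->
    law Y ((\bigcup_n F n) `&` D) = law Y (\bigcup_n F n) * law Y D.
  move=> sD sF tF hF.
  have c1 : (fun n => \sum_(i < n) law Y (F i `&` D)) @ \oo -->
      law Y ((\bigcup_n F n) `&` D).
    rewrite setI_bigcupl; apply: law_sigma => //; first by move=> n; exact: sigI.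
    exact: trivIset_setIr.
  have c2 : (fun n => \sum_(i < n) law Y (F i `&` D)) @ \oo -->
      law Y (\bigcup_n F n) * law Y D.
    have -> : (fun n => \sum_(i < n) law Y (F i `&` D)) =
        (fun n => (\sum_(i < n) law Y (F i)) * law Y D).
      by apply/funext => n; rewrite mulr_suml; apply: eq_bigr => i _; exact: hF.
    by apply: cvgM; [exact: law_sigma|exact: cvg_cst].
  exact: etrans (esym (cvg_lim (@Rhausdorff R) c1)) (cvg_lim (@Rhausdorff R) c2).
move=> J12 sA sB.
have main s : (forall p, p \in s -> J2 p.1) -> forall C, csig J1 C ->
    law Y (C `&` cyl s) = law Y C * law Y (cyl s).
  move=> {A sA B sB} hs; have ss : csig setT (cyl s) by exact: sig_cyl.
  apply: sig_ind.
  - move=> s1 hs1; apply: Yindep => p q /hs1 Jp /hs Jq; apply/eqP => pq.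
    have : (J1 `&` J2) p.1 by split=> //; rewrite pq.
    by rewrite J12.
  - by move=> C sC hC; apply: stepC => //; exact: sT sC.
  - by move=> F sF tF hF; apply: stepU => // n; exact: sT (sF n).
rewrite setIC mulrC; move: B sB; apply: sig_ind.
- by move=> s hs; rewrite setIC mulrC; exact: main.
- by move=> B sB hB; apply: stepC => //; [exact: sT sB|exact: sT sA].
- by move=> F sF tF hF; apply: stepU => // [|n]; [exact: sT sA|exact: sT (sF n)].
Qed.

Lemma law_bigI (T : eqType) (s : seq T) (J : T -> set I) (A : T -> set (I -> V)) :
  uniq s -> (forall t, csig (J t) (A t)) ->
  (forall t u, t \in s -> u \in s -> t != u -> J t `&` J u = set0) ->
  law Y (\big[setI/setT]_(t <- s) A t) = \prod_(t <- s) law Y (A t).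
Proof.
move=> + sA; elim: s => [|t s IH]; first by rewrite !big_nil lawT.
rewrite /= => /andP[ts us] dJ; rewrite !big_cons -IH//; last first.
  by move=> u v uin vin; apply: dJ; rewrite inE ?uin ?vin orbT.
apply: (@law_indep (J t) (\bigcup_(u in [set` s]) J u)) => //.
  rewrite setI_bigcupr bigcup0// => u /= us'; apply: dJ; rewrite ?mem_head//.
    by rewrite inE us' orbT.
  by apply: contraNneq ts => ->.
elim: s {IH ts us dJ} => [|u s IH].
    by rewrite big_nil; exact: sigT.
rewrite big_cons; apply: sigI.
  by apply: sig_mono (sA u) => i Ji; exists u => //=; rewrite mem_head.
by apply: sig_mono IH => i [v vs Ji]; exists v => //=; rewrite inE vs orbT.
Qed.

End Independence.
End Law.

Arguments lawE {R I V dm Om P Y J A}.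
Arguments law_mono {R I V dm Om P Y} _ {A B}.
Arguments law_le1 {R I V dm Om P Y} _ {A}.
Arguments lawC {R I V dm Om P Y} _ {A}.
Arguments law_disjU {R I V dm Om P Y} _ {A B}.
Arguments lawU {R I V dm Om P Y} _ {A B}.
Arguments law_sigma {R I V dm Om P Y} _ {F}.
Arguments law_bigcup_le {R I V dm Om P Y} _ {F M}.
Arguments law_bigcap_cvg0 {R I V dm Om P Y} _ {F}.
Arguments law_bigU {R I V dm Om P Y} _ {T s F}.
Arguments law_ex_le {R I V dm Om P Y} _ {T} s F {A M}.
Arguments law_eq {R I V dm Om P Y1 Y2}.

(** * The lattice with its integer-valued norm *)

Section Lattice.
Variable d : nat.
Implicit Types x y z : lat d.

Definition nrm x : nat := (\sum_(i < d) absz (x 0%R i))%N.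

Lemma norm1E (R : realType) x : norm1 R x = (nrm x)%:R.
Proof.
rewrite /norm1 /nrm natr_sum; apply: eq_bigr => i _.
by rewrite -abszE natr_absz abszE.
Qed.

Lemma nrm0 : nrm 0 = 0%N.
Proof. by rewrite /nrm big1// => i _; rewrite mxE. Qed.

Lemma nrmN x : nrm (- x) = nrm x.
Proof. by apply: eq_bigr => i _; rewrite mxE abszN. Qed.

Lemma nrmB x y : nrm (x - y) = nrm (y - x).
Proof. by rewrite -nrmN opprB. Qed.

Lemma nrmD x y : (nrm (x + y) <= nrm x + nrm y)%N.
Proof.
rewrite /nrm -big_split; apply: leq_sum => i _; rewrite mxE /=; lia.
Qed.

Lemma nrm_coord x i : (absz (x 0%R i) <= nrm x)%N.
Proof. by rewrite /nrm (bigD1 i)//= leq_addr. Qed.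

Lemma nrm_tri x y z : (nrm (x - z) <= nrm (x - y) + nrm (y - z))%N.
Proof. by have := nrmD (x - y) (y - z); rewrite addrA subrK. Qed.

Lemma nrm_leq x n : (forall i, absz (x 0%R i) <= n)%N -> (nrm x <= d * n)%N.
Proof.
move=> h; rewrite /nrm; apply: (@leq_trans (\sum_(i < d) n)); first exact: leq_sum.
by rewrite sum_nat_const card_ord.
Qed.

Definition cube n : seq (lat d) :=
  map (fun f : {ffun 'I_d -> 'I_(n.*2.+1)} => \row_i ((f i : nat)%:Z - n%:Z))
    (enum {ffun 'I_d -> 'I_(n.*2.+1)}).

Lemma size_cube n : size (cube n) = ((n.*2.+1) ^ d)%N.
Proof. by rewrite size_map -cardE card_ffun !card_ord. Qed.

Lemma mem_cube n x : (forall i, absz (x 0%R i) <= n)%N -> x \in cube n.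
Proof.
move=> h; apply/mapP; exists [ffun i => inord (absz (x 0 i + n%:Z))]; rewrite ?mem_enum//.
apply/rowP => i; rewrite !mxE ffunE inordK; have := h i; set z := x 0 i => hz; lia.
Qed.

Lemma mem_cube_nrm n x : (nrm x <= n)%N -> x \in cube n.
Proof. by move=> h; apply: mem_cube => i; apply: leq_trans h; exact: nrm_coord. Qed.

End Lattice.

(** * Configurations, chains of frogs, and the locality of passages *)

Section Configurations.
Variable d : nat.
Local Notation idx := (lat d + (lat d * nat * nat))%type.
Local Notation val := (nat + lat d)%type.
Local Notation cfg := (idx -> val).
Implicit Types (eta : cfg) (x y u v c : lat d) (p : seq (lat d * nat)).

(** Frog counts and walk increments share one index type, as in the independence hypothesis. A value
    of the wrong kind reads as a default; [env] never produces one. *)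
Definition cfg_om eta x : nat := if eta (inl x) is inl n then n else 0%N.

Definition cfg_inc eta x l k : lat d := if eta (inr (x, l, k)) is inr v then v else 0.

Definition cfg_walk eta x l k : lat d := \sum_(j < k) cfg_inc eta x l j.

(** Time [k] need not be the first hitting time. Later hits only add slower chains, which an infimum
    over chains ignores. *)
Definition hit eta u v k :=
  exists l, (l < cfg_om eta u)%N /\ u + cfg_walk eta u l k = v.

Fixpoint chain eta x p : Prop :=
  if p is (v, k) :: p' then hit eta x v k /\ chain eta v p' else True.

Fixpoint slow x p : Prop :=
  if p is (v, k) :: p' then (nrm (v - x) <= k)%N /\ slow v p' else True.

Definition ptime p : nat := sumn (map snd p).

Definition pend x p : lat d := last x (map fst p).

(** Chains of nearest-neighbour walks are [slow] anyway; demanding it here confines a passage of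
    time [t] to the ball of radius [t] for every configuration, not just almost every one. Hence
    [sig_reach] gives exact locality. *)
Definition reach eta x y t :=
  exists p, [/\ slow x p, pend x p = y, ptime p = t & chain eta x p].

Definition site (i : idx) : lat d :=
  match i with inl x => x | inr (x, _, _) => x end.

Definition around x t : set idx := [set i | (nrm (site i - x) <= t)%N].

Lemma sig_om (J : set idx) u n : J (inl u) -> csig J [set eta : cfg | cfg_om eta u = n].
Proof.
move=> Ju.
have -> : [set eta : cfg | cfg_om eta u = n] =
    [set eta | exists v : val, (if v is inl m then m else 0%N) = n /\ eta (inl u) = v].
  apply/seteqP; split=> eta /=; first by move=> <-; exists (eta (inl u)).
  by case=> v [<-]; rewrite /cfg_om => ->.
by apply: sig_ex => v; apply: sig_guard => _; exact: sig_eq.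
Qed.

Lemma sig_om_pred (J : set idx) u (Q : nat -> Prop) :
  J (inl u) -> csig J [set eta : cfg | Q (cfg_om eta u)].
Proof.
move=> Ju.
have -> : [set eta : cfg | Q (cfg_om eta u)] =
    [set eta | exists n : nat, Q n /\ cfg_om eta u = n].
  apply/seteqP; split=> eta /=; first by exists (cfg_om eta u).
  by case=> n [Qn ->].
by apply: sig_ex => n; apply: sig_guard => _; exact: sig_om.
Qed.

Lemma sig_inc (J : set idx) u l k v :
  J (inr (u, l, k)) -> csig J [set eta : cfg | cfg_inc eta u l k = v].
Proof.
move=> Ju.
have -> : [set eta : cfg | cfg_inc eta u l k = v] =
    [set eta | exists a : val, (if a is inr m then m else 0) = v /\ eta (inr (u, l, k)) = a].
  apply/seteqP; split=> eta /=; first by move=> <-; exists (eta (inr (u, l, k))).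
  by case=> a [<-]; rewrite /cfg_inc => ->.
by apply: sig_ex => a; apply: sig_guard => _; exact: sig_eq.
Qed.

Lemma sig_walk (J : set idx) u l k v :
  (forall j, (j < k)%N -> J (inr (u, l, j))) ->
  csig J [set eta : cfg | cfg_walk eta u l k = v].
Proof.
elim: k v => [|k IH] v hJ.
  rewrite (_ : [set _ | _] = [set _ | 0 = v]); first exact: sig_cst.
  by apply/seteqP; split=> eta /=; rewrite /cfg_walk big_ord0.
rewrite (_ : [set _ | _] = [set eta | exists a, cfg_walk eta u l k = a /\
    cfg_inc eta u l k = v - a]).
  apply: sig_ex => a; apply: sigI; first by apply: IH => j jk; apply: hJ; rewrite ltnW.
  by apply: sig_inc; exact: hJ.
apply/seteqP; split=> eta /=; rewrite /cfg_walk big_ord_recr /=.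
  by move=> <-; exists (cfg_walk eta u l k); split=> //; rewrite addrAC subrr add0r.
by case=> a [-> ->]; rewrite addrC subrK.
Qed.

Lemma sig_walk_pred (J : set idx) u l k (Q : lat d -> Prop) :
  (forall j, (j < k)%N -> J (inr (u, l, j))) ->
  csig J [set eta : cfg | Q (cfg_walk eta u l k)].
Proof.
move=> hJ.
have -> : [set eta : cfg | Q (cfg_walk eta u l k)] =
    [set eta | exists n, Q n /\ cfg_walk eta u l k = n].
  apply/seteqP; split=> eta /=; first by exists (cfg_walk eta u l k).
  by case=> n [Qn ->].
by apply: sig_ex => n; apply: sig_guard => _; exact: sig_walk.
Qed.

Lemma sig_hit (J : set idx) u v k : (forall i, site i = u -> J i) ->
  csig J [set eta : cfg | hit eta u v k].
Proof.
move=> hJ; apply: sig_ex => l; apply: sigI; first by apply: (@sig_om_pred J u (fun n => (l < n)%N)); exact: hJ.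
by apply: (@sig_walk_pred J u l k (fun z => u + z = v)) => j _; exact: hJ.
Qed.

Lemma sig_chain (J : set idx) x p :
  (forall v, v \in x :: map fst p -> forall i, site i = v -> J i) ->
  csig J [set eta : cfg | chain eta x p].
Proof.
elim: p x => [|[v k] p IH] x hJ /=.
  by rewrite (_ : [set _ | _] = setT); [exact: sigT|apply/seteqP].
apply: sigI; first by apply: sig_hit => i ix; apply: (hJ x); rewrite ?mem_head.
by apply: IH => u uin i iu; apply: (hJ u) => //; apply: mem_behead.
Qed.

Lemma slow_around x p v : slow x p -> v \in x :: map fst p -> (nrm (v - x) <= ptime p)%N.
Proof.
elim: p x => [|[u k] p IH] x /=.
  by move=> _; rewrite !inE => /eqP ->; rewrite subrr nrm0.
move=> [xu sp]; rewrite inE => /orP[/eqP ->|vin]; first by rewrite subrr nrm0.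
have := IH _ sp vin; have := nrm_tri v u x; rewrite /ptime /=; lia.
Qed.

Lemma sig_reach x y t : csig (around x t) [set eta : cfg | reach eta x y t].
Proof.
rewrite (_ : [set _ | _] = [set eta | exists p,
   [/\ slow x p, pend x p = y & ptime p = t] /\ chain eta x p]).
  apply: sig_ex => p; apply: sig_guard => -[sp _ <-].
  apply: sig_chain => v vin i iv; rewrite /around /= iv; exact: slow_around.
by apply/seteqP; split=> eta [p]; [case=> a b c e|case=> -[a b c] e]; exists p.
Qed.

Lemma slow_cat x p q : slow x (p ++ q) <-> slow x p /\ slow (pend x p) q.
Proof.
elim: p x => [|[v k] p IH] x /=; first by split=> [|[]].
by rewrite IH /pend /=; split=> [[? []]|[[]]].
Qed.

Lemma chain_cat eta x p q :
  chain eta x (p ++ q) <-> chain eta x p /\ chain eta (pend x p) q.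
Proof.
elim: p x => [|[v k] p IH] x /=; first by split=> [|[]].
by rewrite IH /pend /=; split=> [[? []]|[[]]].
Qed.

Lemma ptime_cat p q : ptime (p ++ q) = (ptime p + ptime q)%N.
Proof. by rewrite /ptime map_cat sumn_cat. Qed.

Lemma pend_cat x p q : pend x (p ++ q) = pend (pend x p) q.
Proof. by rewrite /pend map_cat last_cat. Qed.

Lemma reach_trans eta x y z s t : reach eta x y s -> reach eta y z t -> reach eta x z (s + t).
Proof.
move=> [p [sp ep <- cp]] [q [sq eq <- cq]]; exists (p ++ q).
by split; [apply/slow_cat; rewrite ep|rewrite pend_cat ep|rewrite ptime_cat|
  apply/chain_cat; rewrite ep].
Qed.

Lemma reach_nrm eta x y t : reach eta x y t -> (nrm (y - x) <= t)%N.
Proof.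
move=> [p [sp <- <- _]]; apply: slow_around => //.
rewrite /pend; exact: mem_last.
Qed.

Definition shift_idx c (i : idx) : idx :=
  match i with inl x => inl (x + c) | inr (x, l, k) => inr (x + c, l, k) end.

Definition shift_cfg c eta : cfg := fun i => eta (shift_idx c i).

Lemma shift_om c eta x : cfg_om (shift_cfg c eta) x = cfg_om eta (x + c).
Proof. by []. Qed.

Lemma shift_walk c eta x l k : cfg_walk (shift_cfg c eta) x l k = cfg_walk eta (x + c) l k.
Proof. by []. Qed.

Lemma shift_hit c eta u v k : hit (shift_cfg c eta) u v k <-> hit eta (u + c) (v + c) k.
Proof.
split=> -[l [lo h]]; exists l; split=> //.
  by rewrite -h shift_walk addrAC.
by apply: (addIr c); rewrite -h shift_walk addrAC.
Qed.

Definition shift_path c p := [seq (q.1 + c, q.2) | q <- p].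

Lemma shift_reach_sub c eta x y t :
  reach (shift_cfg c eta) x y t -> reach eta (x + c) (y + c) t.
Proof.
move=> [p [sp <- <- cp]]; exists (shift_path c p); split.
- elim: p x sp cp => [|[v k] p IH] x //= [a b] [_ e].
  by split; [rewrite opprD addrACA subrr addr0|exact: IH].
- by elim: p x {sp cp} => [|[v k] p IH] x //=; exact: IH.
- by rewrite /ptime /shift_path -map_comp.
- elim: p x cp {sp} => [|[v k] p IH] x //= [a b].
  by split; [exact/shift_hit|exact: IH].
Qed.

Lemma shiftK c eta : shift_cfg (- c) (shift_cfg c eta) = eta.
Proof.
by apply/funext => -[x|[[x l] k]]; rewrite /shift_cfg /= subrK.
Qed.

Lemma shift_reach c eta x y t :
  reach (shift_cfg c eta) x y t <-> reach eta (x + c) (y + c) t.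
Proof.
split; first exact: shift_reach_sub.
rewrite -{1}(shiftK c eta) => /shift_reach_sub.
by rewrite !addrK.
Qed.

End Configurations.

Arguments sig_reach {d} x y t.

(** * The law of the frog environment, and passage times as chains *)

Section Model.
Context (R : realType) (d : nat) (dm : measure_display) (Om : measurableType dm)
  (P : probability Om R) (om : lat d -> Om -> nat)
  (S : lat d -> nat -> nat -> Om -> lat d).
Local Notation idx := (lat d + (lat d * nat * nat))%type.
Local Notation val := (nat + lat d)%type.
Local Notation cfg := (idx -> val).

Definition env (w : Om) (i : idx) : val :=
  match i with
  | inl x => inl (om x w)
  | inr (x, l, k) => inr (S x l k.+1 w - S x l k w)
  end.

Definition unitv (ib : 'I_d * bool) : lat d :=
  \row_j (if j == ib.1 then (if ib.2 then 1 else -1) else 0).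

Lemma nrm_unitv ib : nrm (unitv ib) = 1%N.
Proof.
case: ib => i b; rewrite /nrm (bigD1 i)//= big1 => [|j /negbTE ji]; last by rewrite mxE /= ji.
by rewrite mxE /= eqxx; case: b.
Qed.

Lemma unitv_inj : injective unitv.
Proof.
case=> i b [j c] h.
have hi : unitv (i, b) 0 i = unitv (j, c) 0 i by rewrite h.
move: hi; rewrite !mxE /= eqxx; have [->|_] := eqVneq i j; last by case: b {h}.
by case: b {h}; case: c.
Qed.

Section Environment.
Hypothesis hom_meas : forall x n, measurable [set w | om x w = n].
Hypothesis hS_meas : forall x l k v, measurable [set w | S x l k w = v].

Lemma measY_env : measY env.
Proof.
move=> [x|[[x l] k]] [n|v] /=.
- rewrite (_ : [set w | _] = [set w | om x w = n])//.
  by apply/seteqP; split=> w /= [->].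
- by rewrite (_ : [set w | _] = set0)//; apply/seteqP; split.
- by rewrite (_ : [set w | _] = set0)//; apply/seteqP; split.
- rewrite (_ : [set w | _] = \bigcup_z
    ([set w | S x l k.+1 w = v + z] `&` [set w | S x l k w = z])).
    by apply: countable_bigcupT_measurable => [|z]; [exact: countableP|exact: measurableI].
  apply/seteqP; split=> w /=.
    by case=> <-; exists (S x l k w) => //; split=> //=; rewrite subrK.
  by case=> z _ [/= -> ->]; rewrite addrK.
Qed.

Hypothesis hom_law : forall x n, P [set w | om x w = n] = P [set w | om 0%R w = n].
Hypothesis hS_step : forall x l k (v : lat d), norm1 R v = 1 ->
     P [set w | S x l k.+1 w - S x l k w = v] = ((2 * d)%:R^-1)%:E.
Hypothesis hd : (0 < d)%N.

Lemma law_step x l k ib :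
  law P env [set eta : cfg | eta (inr (x, l, k)) = inr (unitv ib)] = (2 * d)%:R^-1.
Proof.
rewrite /law (_ : _ @^-1` _ = [set w | S x l k.+1 w - S x l k w = unitv ib]).
  by rewrite hS_step// norm1E nrm_unitv.
by apply/seteqP; split=> w /= [->].
Qed.

(** The hypothesis only gives the mass of each unit vector. The [2 * d] masses already add up to
    one, so every other increment is null. *)
Lemma law_step_unit x l k :
  law P env [set eta : cfg | exists ib, eta (inr (x, l, k)) = inr (unitv ib)] = 1.
Proof.
have mY := measY_env.
set i := inr (x, l, k).
have h (s : seq ('I_d * bool)) : uniq s ->
   law P env [set eta : cfg | exists2 ib, ib \in s & eta i = inr (unitv ib)] =
   (size s)%:R / (2 * d)%:R.
  elim: s => [|ib s IH] /=.
    move=> _; rewrite mul0r (_ : [set _ | _] = set0) ?law0//.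
    by apply/seteqP; split=> eta // [].
  move=> /andP[ibs us].
  have s1 : csig setT [set eta : cfg | eta i = inr (unitv ib)] by exact: sig_eq.
  have s2 : csig setT [set eta : cfg | exists2 ib, ib \in s & eta i = inr (unitv ib)].
    rewrite (_ : [set _ | _] = [set eta | exists ib, ib \in s /\ eta i = inr (unitv ib)]).
      by apply: sig_ex => jb; apply: sig_guard => _; exact: sig_eq.
    by apply/seteqP; split=> eta [jb]; [move=> a b|case=> a b]; exists jb.
  rewrite (_ : [set _ | _] = [set eta : cfg | eta i = inr (unitv ib)] `|`
    [set eta : cfg | exists2 ib, ib \in s & eta i = inr (unitv ib)]); last first.
    apply/seteqP; split=> eta /=.
      by case=> jb; rewrite inE => /orP[/eqP -> ?|? ?]; [left|right; exists jb].
    case=> [?|[jb jbs ?]]; first by exists ib; rewrite ?mem_head.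
    by exists jb; rewrite // inE jbs orbT.
  rewrite law_disjU//.
    by rewrite IH// law_step (_ : (size s).+1 = (1 + size s)%N)// [in RHS]natrD mulrDl mul1r.
  apply/seteqP; split=> eta //= [-> [jb jbs [/unitv_inj e]]].
  by move: ibs; rewrite e jbs.
have := h (enum {: 'I_d * bool}) (enum_uniq _).
rewrite -cardE card_prod card_ord card_bool mulnC divff ?pnatr_eq0; last first.
  by rewrite muln_eq0 -lt0n hd.
move=> <-; congr law; apply/seteqP; split=> eta [ib]; last by move=> _; exists ib.
by exists ib => //; rewrite mem_enum.
Qed.

(** For an increment the two sides agree on unit vectors by hypothesis, and on all other values
    because both vanish by [law_step_unit]. *)
Lemma law_marginal c (i : idx) (v : val) :
  law P env [set eta | eta (shift_idx c i) = v] = law P env [set eta | eta i = v].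
Proof.
have mY := measY_env.
case: i v => [x|[[x l] k]] [n|v] /=.
- rewrite /law (_ : _ @^-1` _ = [set w | om (x + c) w = n]); last first.
    by apply/seteqP; split=> w /= [->].
  rewrite (_ : env @^-1` _ = [set w | om x w = n]); last first.
    by apply/seteqP; split=> w /= [->].
  by rewrite hom_law [in RHS]hom_law.
- by congr fine; congr (P _); apply/seteqP; split.
- by congr fine; congr (P _); apply/seteqP; split.
have [[ib ->]|hv] := pselect (exists ib, v = unitv ib); first by rewrite !law_step.
suff h y : law P env [set eta | eta (inr (y, l, k)) = inr v] = 0 by rewrite !h.
apply/eqP; rewrite eq_le law_ge0 andbT.
have s1 : csig setT [set eta : cfg | exists ib, eta (inr (y, l, k)) = inr (unitv ib)].
  by apply: sig_ex => ib; exact: sig_eq.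
have := lawC (P:=P) mY s1; rewrite law_step_unit subrr => <-.
apply: law_mono => //; [exact: sig_eq|exact: sigC|].
by move=> eta /= -> [ib [e]]; apply: hv; exists ib.
Qed.

Hypothesis hindep : mutually_indep_discrete P
     (fun (i : (lat d + (lat d * nat * nat))%type) (w : Om) =>
        match i with
        | inl x => (inl (om x w) : (nat + lat d)%type)
        | inr (x, l, k) => inr (S x l k.+1 w - S x l k w)
        end).

Definition asg (F : seq idx) (a : idx -> val) : set cfg :=
  [set eta | forall i, i \in F -> eta i = a i].

Lemma law_asg F a : uniq F ->
  law P env (asg F a) = \prod_(i <- F) law P env [set eta | eta i = a i].
Proof.
move=> uF; have := hindep uF a; rewrite /pr /law => h.
by rewrite -[RHS]h; congr fine; congr (P _).
Qed.

Lemma asg_cat F1 F2 a1 a2 : (forall i, i \in F1 -> i \notin F2) ->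
  asg F1 a1 `&` asg F2 a2 = asg (F1 ++ F2) (fun i => if i \in F1 then a1 i else a2 i).
Proof.
move=> h; apply/seteqP; split=> eta /=.
  by case=> H1 H2 i; rewrite mem_cat; case: ifP => [i1 _|_ /= i2]; [exact: H1|exact: H2].
move=> H; split=> i iF; rewrite H ?mem_cat ?iF ?orbT//.
by case: ifP => // /h; rewrite iF.
Qed.

(** Mutual independence is assumed for duplicate-free families, whereas the list of a cylinder may
    repeat or contradict itself. A point of the cylinder, if any, supplies a consistent
    assignment. *)
Lemma cyl_asg (s : seq (idx * val)) :
  cyl s = set0 \/ exists F a, [/\ uniq F, {subset F <= map fst s} & cyl s = asg F a].
Proof.
have [[eta h]|h] := pselect (cyl s !=set0); last first.
  by left; apply/seteqP; split=> // eta heta; apply: h; exists eta.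
right; exists (undup (map fst s)), eta; split.
- exact: undup_uniq.
- by move=> i; rewrite mem_undup.
apply/seteqP; split=> xi /= H.
  by move=> i; rewrite mem_undup => /mapP[p ps ->]; rewrite H// h.
by move=> p ps; rewrite H ?h// mem_undup; apply/mapP; exists p.
Qed.

Lemma env_indep : cyl_indep P env.
Proof.
move=> s1 s2 h.
have [->|[F1 [a1 [u1 sub1 ->]]]] := cyl_asg s1; first by rewrite set0I law0 mul0r.
have [->|[F2 [a2 [u2 sub2 ->]]]] := cyl_asg s2; first by rewrite setI0 law0 mulr0.
have F12 i : i \in F1 -> i \notin F2.
  move=> /sub1/mapP[p ps ->]; apply/negP => /sub2/mapP[q qs] pq.
  by have := h _ _ ps qs; rewrite pq eqxx.
rewrite asg_cat// law_asg; last first.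
  rewrite cat_uniq u1 u2 andbT; apply/hasPn => i i2; apply/negP => /F12.
  by rewrite i2.
rewrite big_cat /= !law_asg//; congr (_ * _); apply: eq_big_seq => i iF.
  by rewrite iF.
by case: ifP => // /F12; rewrite iF.
Qed.

Lemma shift_idxK c : cancel (@shift_idx d c) (shift_idx (- c)).
Proof. by case=> [x|[[x l] k]] /=; rewrite addrK. Qed.

Lemma law_shift c (A : set cfg) : csig setT A ->
  law P env [set eta | A (shift_cfg c eta)] = law P env A.
Proof.
move=> sA; have mY := measY_env.
have mYc : measY (fun w => shift_cfg c (env w)) by move=> i v; exact: mY.
suff : law P (fun w => shift_cfg c (env w)) A = law P env A by [].
move: A sA; apply: law_eq => // s.
have [->|[F [a [uF _ ->]]]] := cyl_asg s; first by rewrite !law0.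
have -> : law P (fun w => shift_cfg c (env w)) (asg F a) =
    law P env (asg (map (shift_idx c) F) (a \o shift_idx (- c))).
  congr fine; congr (P _); apply/seteqP; split=> w /= H.
    by move=> _ /mapP[i iF ->]; rewrite /= shift_idxK; exact: (H i iF).
  by move=> i iF; rewrite /shift_cfg H ?map_f//= shift_idxK.
rewrite !law_asg// ?map_inj_uniq//; last exact: can_inj (shift_idxK c).
by rewrite big_map; apply: eq_bigr => i _ /=; rewrite shift_idxK law_marginal.
Qed.

End Environment.

Hypothesis hS0 : forall x l w, S x l 0%N w = x.

Lemma env_walk w x l k : x + cfg_walk (env w) x l k = S x l k w.
Proof.
rewrite /cfg_walk; elim: k => [|k IH]; first by rewrite big_ord0 addr0 hS0.
by rewrite big_ord_recr /= addrA IH /cfg_inc /= addrC subrK.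
Qed.

Lemma env_hit w x y k : hit (env w) x y k <-> exists l, (l < om x w)%N /\ S x l k w = y.
Proof. by split=> -[l [lo h]]; exists l; split=> //; rewrite -h env_walk. Qed.

Lemma tau_val w x y : tau R om S x y w = +oo%E \/
  exists k, hit (env w) x y k /\ tau R om S x y w = (k%:R)%:E.
Proof.
rewrite /tau; pose A := [set k : nat | exists l : nat, (l < om x w)%N /\ S x l k w = y].
rewrite -/A.
have [hA|hA] := pselect (exists k, `[< A k >]); last first.
  left; suff -> : A = set0 by rewrite image_set0 ereal_inf0.
  by apply/seteqP; split=> // k Ak; apply: hA; exists k; apply/asboolP.
right; case: (ex_minnP hA) => k /asboolP Ak kmin; exists k; split; first exact/env_hit.
apply/eqP; rewrite eq_le; apply/andP; split.
  by apply: ereal_inf_lbound; exists k.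
apply: le_ereal_inf_tmp => _ [j Aj <-]; rewrite lee_fin ler_nat.
by apply: kmin; apply/asboolP.
Qed.

Lemma hit_tau w x y k : hit (env w) x y k -> (tau R om S x y w <= (k%:R)%:E)%E.
Proof. by move=> /env_hit h; apply: ereal_inf_lbound; exists k. Qed.

Lemma tau_ge0 w x y : (0 <= tau R om S x y w)%E.
Proof. by have [->|[k [_ ->]]] := tau_val w x y; rewrite // lee_fin. Qed.

Lemma path_time_val w x (p : seq (lat d)) :
  (\sum_(ab <- zip (x :: p) p) tau R om S ab.1 ab.2 w)%E = +oo%E \/
  exists q, [/\ map fst q = p, chain (env w) x q &
    (\sum_(ab <- zip (x :: p) p) tau R om S ab.1 ab.2 w)%E = ((ptime q)%:R)%:E].
Proof.
elim: p x => [|y p IH] x.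
  by right; exists [::]; split=> //; rewrite /= big_nil.
rewrite -[zip _ _]/((x, y) :: zip (y :: p) p) big_cons /=.
have s0 : (0 <= \sum_(ab <- zip (y :: p) p) tau R om S ab.1 ab.2 w)%E.
  by apply: sume_ge0 => ab _; exact: tau_ge0.
have [->|[k [hk ->]]] := tau_val w x y.
  by left; rewrite addye// -ltNye; apply: lt_le_trans s0.
have [->|[q [qp cq ->]]] := IH y; first by left.
right; exists ((y, k) :: q); split=> //=; first by rewrite qp.
by rewrite /ptime /= natrD.
Qed.

Lemma fpt_chain w x y (a : R) : (fpt R om S x y w <= a%:E)%E ->
  exists q, [/\ pend x q = y, chain (env w) x q & (ptime q)%:R <= a].
Proof.
move=> h.
have [a0|a0] := ltP a 0.
  have : (0 <= fpt R om S x y w)%E.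
    apply: le_ereal_inf_tmp => _ [p _ <-].
    by apply: sume_ge0 => ab _; exact: tau_ge0.
  by move=> /le_trans /(_ h); rewrite lee_fin leNgt a0.
(* Chain times are integers, so a chain of time below the integer following [a] has time at most
   [a]. No attained infimum is needed. *)
have : (fpt R om S x y w < ((Num.truncn a).+1%:R)%:E)%E.
  by apply: le_lt_trans h _; rewrite lte_fin truncnS_gt.
move=> /ereal_inf_lt [_ [p [_ py] <-]].
have [->//|[q [qp cq ->]]] := path_time_val w x p.
rewrite lte_fin ltr_nat ltnS => qa; exists q; split=> //.
  by rewrite /pend qp.
by apply: (@le_trans _ _ (Num.truncn a)%:R); rewrite ?ler_nat// truncn_le.
Qed.

Lemma chain_fpt w x y q : pend x q = y -> x != y -> chain (env w) x q ->
  (fpt R om S x y w <= ((ptime q)%:R)%:E)%E.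
Proof.
move=> qy xy cq.
apply: (@le_trans _ _ (\sum_(ab <- zip (x :: map fst q) (map fst q)) tau R om S ab.1 ab.2 w)%E).
  apply: ereal_inf_lbound; exists (map fst q) => //; split=> //.
  by case: q qy {cq} => // xy'; move: xy; rewrite -xy' eqxx.
elim: q x {qy xy} cq => [|[v k] q IH] x /=; first by rewrite big_nil.
move=> [hk cq].
rewrite big_cons /= /ptime /= natrD EFinD; apply: leeD; first exact: hit_tau.
exact: IH.
Qed.

End Model.

(** * Chernoff bound for the walks and for long jumps *)

Lemma expR_cosh_le (R : realType) (l : R) : 0 <= l -> l ^+ 2 <= 2^-1 ->
  expR l + expR (- l) <= 2 * expR (2 * l ^+ 2).
Proof.
move=> l0 l2.
have l1 : l < 1 by nra.
(* This bound and the next one add up to [2 / (1 - l^2)], which is at most [2 (1 + 2 l^2)] as long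
   as [l^2 <= 1/2]. *)
have e1 : expR l <= (1 - l)^-1.
  rewrite -[l in expR l]opprK expRN lef_pV2 ?posrE ?expR_gt0//; last by lra.
  by have := expR_ge1Dx (- l).
have e2 : expR (- l) <= (1 + l)^-1.
  rewrite expRN lef_pV2 ?posrE ?expR_gt0//; last by lra.
  exact: expR_ge1Dx.
have e3 := expR_ge1Dx (2 * l ^+ 2).
have p1 : 0 < 1 - l by lra.
have p2 : 0 < 1 + l by lra.
have : (1 - l)^-1 + (1 + l)^-1 <= 2 * (1 + 2 * l ^+ 2).
  rewrite -(@ler_pM2r _ ((1 - l) * (1 + l))) ?mulr_gt0//.
  rewrite (_ : _ * ((1 - l) * (1 + l)) = 2); last by field; lra.
  nra.
lra.
Qed.

Section RandomWalk.
Context (R : realType) (d : nat) (dm : measure_display) (Om : measurableType dm)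
  (P : probability Om R).
Local Notation idx := (lat d + (lat d * nat * nat))%type.
Local Notation val := (nat + lat d)%type.
Local Notation cfg := (idx -> val).
Variable Y : Om -> cfg.
Hypothesis mY : measY Y.
Hypothesis Yindep : cyl_indep P Y.
Hypothesis Yshift : forall c (A : set cfg), csig setT A ->
  law P Y [set eta | A (shift_cfg c eta)] = law P Y A.
Hypothesis Ystep : forall x l k ib,
  law P Y [set eta : cfg | eta (inr (x, l, k)) = inr (unitv ib)] = (2 * d)%:R^-1.
Hypothesis Yunit : forall x l k,
  law P Y [set eta : cfg | exists ib, eta (inr (x, l, k)) = inr (unitv ib)] = 1.
Hypothesis hd : (0 < d)%N.

Definition signed_coord (jb : 'I_d * bool) (z : lat d) : R :=
  if jb.2 then (z 0 jb.1)%:~R else - (z 0 jb.1)%:~R.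

Lemma signed_coordD jb z1 z2 :
  signed_coord jb (z1 + z2) = signed_coord jb z1 + signed_coord jb z2.
Proof. by rewrite /signed_coord !mxE rmorphD /=; case: jb.2; rewrite ?opprD. Qed.

Lemma unitv_cosh jb i (lam : R) : 0 <= lam -> lam ^+ 2 <= 2^-1 ->
  expR (lam * signed_coord jb (unitv (i, true))) +
  expR (lam * signed_coord jb (unitv (i, false))) <= 2 * expR (2 * lam ^+ 2).
Proof.
move=> l0 l2; have h := expR_cosh_le l0 l2.
rewrite /signed_coord /unitv !mxE /=; case: eqP => _; case: jb.2;
  rewrite ?mulr1 ?mulrN1 ?opprK ?mulr1z ?mulrN1z ?mulr1 ?mulrN1 ?opprK ?oppr0 ?mulr0 ?mulr0z ?mulr0 ?expR0//.
- by rewrite addrC.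
- by have := expR_ge1Dx (2 * lam ^+ 2); nra.
- by have := expR_ge1Dx (2 * lam ^+ 2); nra.
Qed.

Lemma sig_signed_walk J jb u l k (a : R) :
  (forall j, (j < k)%N -> J (inr (u, l, j))) ->
  csig J [set eta : cfg | a <= signed_coord jb (cfg_walk eta u l k)].
Proof. by move=> h; apply: (@sig_walk_pred d J u l k (fun z => a <= signed_coord jb z)). Qed.

(** A Chernoff bound without integration: splitting by the last increment makes the tail at [k.+1]
    an average of tails at [k] with shifted thresholds. The shifts cost one factor
    [expR (2 * lam ^+ 2)] per step. *)
Lemma walk_tail jb u l k (a lam : R) : 0 <= lam -> lam ^+ 2 <= 2^-1 ->
  law P Y [set eta : cfg | a <= signed_coord jb (cfg_walk eta u l k)] <=
  expR (2 * lam ^+ 2 * k%:R - lam * a).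
Proof.
move=> l0 l2; elim: k a => [|k IH] a.
  rewrite (_ : [set _ | _] = [set _ | a <= 0]); last first.
    apply/seteqP; split=> eta /=; rewrite /cfg_walk big_ord0 /signed_coord mxE;
      by case: jb.2; rewrite ?oppr0.
  have [a0|a0] := leP a 0; last first.
    rewrite (_ : [set _ | _] = set0) ?law0 ?expR_ge0//.
    by apply/seteqP; split=> // eta /=.
  apply: (@le_trans _ _ 1); first by apply: law_le1 => //; exact: sig_cst.
  rewrite -expR0 ler_expR mulr0 sub0r -mulrN mulr_ge0// oppr_ge0//.
pose B ib : set cfg := [set eta | eta (inr (u, l, k)) = inr (unitv ib)] `&`
   [set eta | a - signed_coord jb (unitv ib) <= signed_coord jb (cfg_walk eta u l k)].
pose N : set cfg := [set eta | exists ib, eta (inr (u, l, k)) = inr (unitv ib)].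
have sN : csig setT N by apply: sig_ex => ib; exact: sig_eq.
have sB ib : csig setT (B ib).
  by apply: sigI; [exact: sig_eq|exact: sig_signed_walk].
have sU : csig setT (\big[setU/set0]_(ib <- enum {: 'I_d * bool}) B ib).
  by elim/big_ind: _ => //; [exact: sig0|move=> ? ?; exact: sigU].
have sub : [set eta : cfg | a <= signed_coord jb (cfg_walk eta u l k.+1)] `<=`
    ~` N `|` \big[setU/set0]_(ib <- enum {: 'I_d * bool}) B ib.
  move=> eta /= h; have [[ib hib]|hN] := pselect (N eta); last by left.
  right; rewrite -bigcup_seq; exists ib; first by rewrite /= mem_enum.
  split=> //=; move: h; rewrite /cfg_walk big_ord_recr /= signed_coordD.
  by rewrite {2}/cfg_inc hib lerBlDr.
apply: le_trans (law_mono mY _ (sigU (sigC sN) sU) sub) _.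
  exact: sig_signed_walk.
apply: le_trans (lawU mY (sigC sN) sU) _.
rewrite lawC// Yunit subrr add0r.
apply: le_trans (law_bigU mY sB) _.
have lB ib : law P Y (B ib) <= (2 * d)%:R^-1 *
    (expR (2 * lam ^+ 2 * k%:R - lam * a) * expR (lam * signed_coord jb (unitv ib))).
  rewrite (law_indep mY Yindep (J1 := [set inr (u, l, k)])
    (J2 := [set i | exists2 j, (j < k)%N & i = inr (u, l, j)])).
  - rewrite Ystep ler_wpM2l ?invr_ge0 ?ler0n// -expRD.
    by apply: le_trans (IH _) _; rewrite ler_expR mulrBr opprB addrA addrAC.
  - apply/seteqP; split=> // i /= [-> [j jk [e]]]; move: jk; rewrite e ltnn.
    by [].
  - exact: sig_eq.
  - by apply: sig_signed_walk => j jk; exists j.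
apply: le_trans (ler_sum _ (fun ib _ => lB ib)) _.
rewrite -mulr_sumr -mulr_sumr.
have -> : \sum_(ib <- enum {: 'I_d * bool}) expR (lam * signed_coord jb (unitv ib)) =
    \sum_(i < d) (expR (lam * signed_coord jb (unitv (i, true))) +
                  expR (lam * signed_coord jb (unitv (i, false)))).
  rewrite big_enum /= -(pair_bigA _ (fun i b => expR (lam * signed_coord jb (unitv (i, b))))) /=.
  by apply: eq_bigr => i _; rewrite big_bool.
have -> : 2 * lam ^+ 2 * k.+1%:R - lam * a =
    (2 * lam ^+ 2 * k%:R - lam * a) + 2 * lam ^+ 2.
  by rewrite -natr1; ring.
set e := 2 * lam ^+ 2 * k%:R - lam * a.
rewrite (expRD e) mulrCA ler_wpM2l ?expR_ge0//.
rewrite mulrC ler_pdivrMr ?ltr0n ?muln_gt0 ?hd//.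
apply: le_trans (ler_sum _ (fun i _ => unitv_cosh jb i l0 l2)) _.
by rewrite sumr_const card_ord -mulr_natl natrM; lra.
Qed.

Lemma nrm_signed_coord (h : nat) (z : lat d) : (h <= nrm z)%N ->
  exists jb, h%:R / d%:R <= signed_coord jb z.
Proof.
move=> hz; have d0 : 0 < d%:R :> R by rewrite ltr0n.
have [[j hj]|H] := pselect (exists j : 'I_d, (h <= d * absz (z 0%R j))%N).
  exists (j, 0 <= z 0 j); rewrite ler_pdivrMr// /signed_coord /=.
  have -> : (if 0 <= z 0 j then (z 0 j)%:~R else - (z 0 j)%:~R) = (absz (z 0 j))%:R :> R.
    rewrite natr_absz; case: ifP => [h0|/negbT]; first by rewrite ger0_norm.
    by rewrite -ltNge => h0; rewrite ltr0_norm// rmorphN.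
  by rewrite -natrM ler_nat mulnC.
exfalso; have : (d * nrm z <= d * h.-1)%N.
  rewrite /nrm big_distrr /= -[X in (_ <= X)%N](_ : \sum_(i < d) h.-1 = d * h.-1)%N.
    apply: leq_sum => i _; rewrite -ltnS; apply: leq_trans (leqSpred _).
    by rewrite ltnNge; apply/negP => hi; apply: H; exists i.
  by rewrite sum_nat_const card_ord.
rewrite leq_pmul2l// => h2.
have h0 : h = 0%N by lia.
by apply: H; exists (Ordinal hd); rewrite h0.
Qed.

Lemma walk_nrm_tail u l k (h : nat) (lam : R) : 0 <= lam -> lam ^+ 2 <= 2^-1 ->
  law P Y [set eta : cfg | (h <= nrm (cfg_walk eta u l k))%N] <=
  (2 * d)%:R * expR (2 * lam ^+ 2 * k%:R - lam * (h%:R / d%:R)).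
Proof.
move=> l0 l2.
have -> : (2 * d)%N = size (enum {: 'I_d * bool}).
  by rewrite -cardE card_prod card_ord card_bool mulnC.
apply: (law_ex_le mY (enum {: 'I_d * bool})
  (fun jb eta => h%:R / d%:R <= signed_coord jb (cfg_walk eta u l k))).
- exact: (@sig_walk_pred d setT u l k (fun z => (h <= nrm z)%N)).
- by move=> jb; exact: sig_signed_walk.
- by move=> jb _; exact: walk_tail.
- by move=> eta /nrm_signed_coord[jb hjb]; exists jb => //; rewrite mem_enum.
Qed.

Definition jump (t h : nat) (u : lat d) : set cfg :=
  [set eta | exists l k, [/\ (l < cfg_om eta u)%N, (k <= t)%N & (h <= nrm (cfg_walk eta u l k))%N]].

Lemma sig_jump t h u : csig setT (jump t h u).
Proof.
apply: sig_ex => l; apply: sig_ex => k.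
rewrite (_ : [set _ | _] = [set eta | (k <= t)%N /\ ((l < cfg_om eta u)%N /\
  (h <= nrm (cfg_walk eta u l k))%N)]).
  apply: sig_guard => _; apply: sigI; first exact: (@sig_om_pred d setT u (fun n => (l < n)%N)).
  exact: (@sig_walk_pred d setT u l k (fun z => (h <= nrm z)%N)).
by apply/seteqP; split=> eta /= []// ? []; split.
Qed.

Variable Mom : R.
Hypothesis hMom : forall n, \sum_(l < n) law P Y [set eta : cfg | (l < cfg_om eta 0%R)%N] <= Mom.

(** The finite mean enters here. The walk with label [l] is independent of the event that it exists,
    and the probabilities of the latter sum over [l] to at most [Mom]. *)
Lemma law_jump t h u (lam : R) : 0 <= lam -> lam ^+ 2 <= 2^-1 ->
  law P Y (jump t h u) <=
  Mom * (t.+1%:R * ((2 * d)%:R * expR (2 * lam ^+ 2 * t%:R - lam * (h%:R / d%:R)))).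
Proof.
move=> l0 l2.
have -> : law P Y (jump t h u) = law P Y (jump t h 0).
  rewrite -(Yshift u (sig_jump t h 0)); congr law.
  apply/seteqP; split=> eta [l [k]]; last first.
    by rewrite shift_om shift_walk add0r; exists l, k.
  by exists l, k; rewrite shift_om shift_walk add0r.
set E := expR _.
pose W l : set cfg := [set eta | exists2 k, k \in iota 0 t.+1 & (h <= nrm (cfg_walk eta 0 l k))%N].
pose V l : set cfg := [set eta | (l < cfg_om eta 0)%N].
pose JW l : set idx := [set i | exists j, i = inr (0, l, j)].
have sW l : csig (JW l) (W l).
  rewrite (_ : W l = [set eta | exists k, k \in iota 0 t.+1 /\ (h <= nrm (cfg_walk eta 0 l k))%N]).
    apply: sig_ex => k; apply: sig_guard => _.
    by apply: (@sig_walk_pred d _ 0 l k (fun z => (h <= nrm z)%N)) => j _; exists j.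
  by apply/seteqP; split=> eta [k]; [move=> a b|case=> a b]; exists k.
have sV l : csig [set inl 0] (V l) by exact: (@sig_om_pred d _ 0 (fun n => (l < n)%N)).
have sT (J : set idx) (A : set cfg) : csig J A -> csig setT A by apply: (@sig_mono idx val J setT).
have -> : jump t h 0 = \bigcup_l (V l `&` W l).
  apply/seteqP; split=> eta.
    move=> [l [k [a b c]]]; exists l => //; split=> //; exists k => //.
    by rewrite mem_iota.
  by move=> [l _ [a [k]]]; rewrite mem_iota => b c; exists l, k.
have lW l : law P Y (W l) <= t.+1%:R * ((2 * d)%:R * E).
  rewrite -[in leRHS](size_iota 0 t.+1).
  apply: (law_ex_le mY (iota 0 t.+1) (fun k eta => (h <= nrm (cfg_walk eta 0 l k))%N)).
  - exact: sT (sW l).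
  - by move=> k; exact: (@sig_walk_pred d setT 0 l k (fun z => (h <= nrm z)%N)).
  - move=> k; rewrite mem_iota ltnS /= => kt.
    apply: le_trans (walk_nrm_tail _ _ _ _ l0 l2) _.
    rewrite ler_wpM2l ?ler0n// ler_expR lerD2r ler_wpM2l ?ler_nat//.
    by rewrite mulr_ge0// exprn_ge0.
  - by [].
have K0 : 0 <= t.+1%:R * ((2 * d)%:R * E) by rewrite !mulr_ge0 ?ler0n ?expR_ge0.
apply: (law_bigcup_le mY) => [l|n].
  by apply: sigI; [exact: sT (sV l)|exact: sT (sW l)].
apply: (@le_trans _ _ (\sum_(l < n) law P Y (V l) * (t.+1%:R * ((2 * d)%:R * E)))).
  apply: ler_sum => l _.
  rewrite (law_indep mY Yindep (J1 := [set inl 0]) (J2 := JW l))//.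
    by rewrite ler_wpM2l// law_ge0.
  by apply/seteqP; split=> // i /= [-> [j]].
by rewrite -mulr_suml ler_wpM2r.
Qed.

End RandomWalk.

(** * Fast cells become rare as their side grows *)

Section FastBoxes.
Context (R : realType) (d : nat) (dm : measure_display) (Om : measurableType dm)
  (P : probability Om R).
Local Notation idx := (lat d + (lat d * nat * nat))%type.
Local Notation val := (nat + lat d)%type.
Local Notation cfg := (idx -> val).
Variable mu : lat d -> R.
Variable C : nat.
Hypothesis muD : forall x y, mu (x + y) <= mu x + mu y.
Hypothesis muN : forall x, mu (- x) = mu x.
Hypothesis muC : forall x, mu x <= C%:R * (nrm x)%:R.

(** This is [|T(p,x) - mu(x - p)| <= e |x - p|], phrased through passages so that it is an event on
    configurations. *)
Definition typical (e : R) (eta : cfg) (p x : lat d) : Prop :=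
  (exists t, (t%:R <= mu (x - p) + e * (nrm (x - p))%:R) /\ reach eta p x t) /\
  (forall t, ~ (t%:R < mu (x - p) - e * (nrm (x - p))%:R /\ reach eta p x t)).

(** All targets beyond [r] are taken at once. The events decrease in [r], and their intersection
    contradicts the convergence to [mu], so their probability tends to zero. *)
Definition deviant (e : R) (r : nat) (p : lat d) : set cfg :=
  [set eta | (0 < cfg_om eta p)%N /\
    exists x, (r <= nrm (x - p))%N /\ ~ typical e eta p x].

Lemma sig_reachT x y t : csig setT [set eta : cfg | reach eta x y t].
Proof. by apply: (sigW _ (sig_reach x y t)). Qed.

Lemma sig_deviant e r p : csig setT (deviant e r p).
Proof.
apply: sigI; first exact: (@sig_om_pred d setT p (fun n => (0 < n)%N)).
apply: sig_ex => x; apply: sig_guard => _; apply: sigC; apply: sigI.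
  by apply: sig_ex => t; apply: sig_guard => _; exact: sig_reachT.
by apply: sig_all => t; apply: sigC; apply: sig_guard => _; exact: sig_reachT.
Qed.

Lemma shift_reachE c (eta : cfg) x y t :
  reach (shift_cfg c eta) x y t = reach eta (x + c) (y + c) t.
Proof. exact/propext/shift_reach. Qed.

Lemma shift_typical e eta p x : typical e (shift_cfg p eta) 0 x <-> typical e eta p (x + p).
Proof.
rewrite /typical subr0 addrK.
have h t := shift_reachE p eta 0 x t; rewrite add0r in h.
split=> -[[t [a b]] k]; split.
- by exists t; rewrite -h.
- by move=> s; rewrite -h; exact: k.
- by exists t; rewrite h.
- by move=> s; rewrite h; exact: k.
Qed.

Lemma shift_deviant e r p : deviant e r p = [set eta | deviant e r 0 (shift_cfg p eta)].
Proof.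
apply/seteqP; split=> eta [om0 [x [rx nt]]].
  split; first by rewrite shift_om add0r.
  by exists (x - p); rewrite subr0; split=> // /shift_typical; rewrite subrK.
split; first by move: om0; rewrite shift_om add0r.
exists (x + p); rewrite addrK; move: rx; rewrite subr0 => rx; split=> //.
by move=> /shift_typical.
Qed.

(** The bounds on [z - y] are those of the legs cut from a chain. The upper one also caps [t] by
    [2 * C * H * h], which yields the radius in [sig_fast]. *)
Definition fast (e : R) (H h : nat) (c : lat d) : set cfg :=
  [set eta | exists yzt : lat d * lat d * nat,
    let '(y, z, t) := yzt in
    [/\ (nrm (y - c) <= d * h)%N, (H * h < nrm (z - y))%N,
        (nrm (z - y) <= 2 * (H * h))%N & t%:R < mu (z - y) - e * (nrm (z - y))%:R]
    /\ reach eta y z t].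

Lemma sig_fast e H h c : 0 <= e ->
  csig (around c ((d + 2 * C * H) * h)) (fast e H h c).
Proof.
move=> e0; apply: sig_ex => -[[y z] t]; apply: sig_guard => -[a b c' t1].
apply: (sigW _ (sig_reach y z t)) => i; rewrite /around /= => it.
have : (t <= C * (2 * (H * h)))%N.
  rewrite -(ler_nat R); apply: le_trans (ltW t1) _.
  apply: (@le_trans _ _ (mu (z - y))); first by rewrite gerBl mulr_ge0.
  apply: le_trans (muC _) _; rewrite [in leRHS]natrM ler_wpM2l// ler_nat//.
move=> tC; apply: leq_trans (nrm_tri _ y _) _; nia.
Qed.

Lemma shift_fast e H h c : fast e H h c = [set eta | fast e H h 0 (shift_cfg c eta)].
Proof.
apply/seteqP; split=> eta [[[y z] t]].
  move=> [[a b f g] r]; exists (y - c, z - c, t).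
  rewrite shift_reachE !subrK !opprB subr0 addrA subrK.
  by split; first split.
move=> [[a b f g]]; rewrite shift_reachE => r; exists (y + c, z + c, t).
rewrite addrK opprD addrACA subrr addr0; split=> //; split=> //.
by move: a; rewrite subr0.
Qed.

Variable Y : Om -> cfg.
Hypothesis mY : measY Y.
Hypothesis Yshift : forall c (A : set cfg), csig setT A ->
  law P Y [set eta | A (shift_cfg c eta)] = law P Y A.
Variable zeta : R.
Hypothesis zeta01 : 0 <= zeta < 1.
Hypothesis Yvacant : forall F : seq (lat d), uniq F ->
  law P Y [set eta | forall p : lat d, p \in F -> cfg_om eta p = 0%N] <= zeta ^+ size F.
Hypothesis Ydeviant : forall e, 0 < e -> law P Y (\bigcap_r deviant e r 0) = 0.
Hypothesis hd : (0 < d)%N.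

Lemma law_fast_shift e H h c : 0 <= e -> law P Y (fast e H h c) = law P Y (fast e H h 0).
Proof.
move=> e0; rewrite shift_fast; apply: Yshift.
by apply: (sigW _ (@sig_fast e H h 0 e0)).
Qed.

Definition axis (a : nat) : lat d := \row_j (if j == Ordinal hd then a%:Z else 0).

Lemma nrm_axis a : nrm (axis a) = a.
Proof.
rewrite /nrm (bigD1 (Ordinal hd))//= big1 ?addn0 ?mxE ?eqxx// => j /negbTE jh.
by rewrite mxE jh.
Qed.

Lemma axis_inj : injective axis.
Proof. by move=> a b h; rewrite -(nrm_axis a) h nrm_axis. Qed.

(* If a source [p] at distance of order [d h] from the box is occupied and
   typical, then [T(y,z) >= T(p,z) - T(p,y)] forbids fast passages from the box. *)
Lemma fast_deviant e H h (F : seq (lat d)) (eta : cfg) :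
  0 < e <= 1 -> 16 * d%:R * (C%:R + 1) <= e * H%:R -> (0 < h)%N ->
  (forall p : lat d, p \in F -> forall y, (nrm y <= d * h)%N ->
     (d * h <= nrm (y - p) <= 4 * (d * h))%N) ->
  fast e H h 0 eta ->
  (forall p : lat d, p \in F -> cfg_om eta p = 0%N) \/
  exists2 p : lat d, p \in F & deviant (e / 2) (d * h) p eta.
Proof.
move=> /andP[e0 e1] hH h0 hF [[[y z] t]] [[ys lo hi tlt] r].
have [?|hom] := pselect (forall p : lat d, p \in F -> cfg_om eta p = 0%N); [by left|right].
have [p [pF op]] : exists p : lat d, p \in F /\ (0 < cfg_om eta p)%N.
  apply: contrapT => hn; apply: hom => p pF; apply/eqP; rewrite -leqn0 leqNgt.
  by apply/negP => ?; apply: hn; exists p.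
exists p => //; split=> //.
rewrite subr0 in ys; have /andP[yp1 yp2] := hF p pF y ys.
have H16 : (16 * d <= H)%N.
  rewrite -(ler_nat R) natrM; apply: le_trans (_ : e * H%:R <= _).
    apply: le_trans hH; rewrite ler_peMr ?mulr_ge0//.
    by rewrite lerDr.
  by rewrite ler_piMl.
have [ty|] := pselect (typical (e / 2) eta p y); last by exists y.
exists z; split.
  have := nrm_tri z p y; rewrite (nrmB p y).
  have : (16 * (d * h) <= H * h)%N by rewrite mulnA leq_mul2r H16 orbT.
  move: lo yp2; set A := (d * h)%N; set B := (H * h)%N.
  by move: (nrm (z - y)) (nrm (z - p)) (nrm (y - p)) A B => a1 a2 a3 A B; lia.
move=> [_ /(_ _)] tz.
have [[t1 [t1le r1]] _] := ty.
apply: (tz (t1 + t)%N); split; last exact: reach_trans r1 r.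
(* What is needed is [2 mu(y - p) + e |y - p| <= (e/2) |z - y|]. The left side is at most
   [(8 C + 4) d h] and the right side at least [8 d (C + 1) h]; this is the origin of the constant
   16. *)
have a1 : mu (z - y) <= mu (z - p) + mu (y - p).
  by rewrite -(muN (y - p)) opprB; have := muD (z - p) (p - y); rewrite addrA subrK.
have a2 : mu (y - p) <= C%:R * (4 * (d%:R * h%:R)).
  apply: le_trans (muC _) _; rewrite ler_wpM2l//.
  by rewrite -!natrM ler_nat.
have a3 : (nrm (z - p))%:R <= (nrm (z - y))%:R + (nrm (y - p))%:R :> R.
  by rewrite -natrD ler_nat nrm_tri.
have a4 : (nrm (y - p))%:R <= 4 * (d%:R * h%:R) :> R.
  by rewrite -!natrM ler_nat.
have a5 : H%:R * h%:R <= (nrm (z - y))%:R :> R.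
  by rewrite -natrM ler_nat ltnW.
have a6 : 16 * d%:R * (C%:R + 1) * h%:R <= e * (nrm (z - y))%:R.
  apply: (@le_trans _ _ (e * H%:R * h%:R)); first by rewrite ler_wpM2r.
  by rewrite -mulrA ler_wpM2l// ltW.
have a7 : e * (nrm (y - p))%:R <= 4 * (d%:R * h%:R).
  apply: le_trans a4; rewrite ler_piMl//.
rewrite natrD.
have a8 : e * (nrm (z - p))%:R <= e * (nrm (z - y))%:R + e * (nrm (y - p))%:R.
  by rewrite -mulrDr ler_wpM2l// ltW.
have a9 : 16 * d%:R * (C%:R + 1) * h%:R =
  4 * (C%:R * (4 * (d%:R * h%:R))) + 4 * (4 * (d%:R * h%:R)) :> R by ring.
have a0 : 0 <= (d%:R * h%:R : R) by rewrite mulr_ge0.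
lra.
Qed.

(** The order of choices replaces a rate: [zeta ^+ M <= delta / 2] fixes the number [M] of sources,
    and only then is [h] taken so large that each of them deviates with probability at most
    [delta / 2 / M.+1]. *)
Lemma law_fast_small e H : 0 < e <= 1 -> 16 * d%:R * (C%:R + 1) <= e * H%:R ->
  forall delta, 0 < delta -> exists h0, forall h, (h0 <= h)%N ->
    law P Y (fast e H h 0) <= delta.
Proof.
move=> e01 hH delta d0; have /andP[e0 e1] := e01.
have /andP[z0 z1] := zeta01.
have [M hM] : exists M, zeta ^+ M <= delta / 2.
  have : (fun n => zeta ^+ n) @ \oo --> (0 : R) by apply: cvg_expr; rewrite ger0_norm.
  move=> /cvgrPdist_le /(_ (delta / 2)); case; first by rewrite divr_gt0.
  move=> M _ /(_ M (leqnn M)); rewrite /= sub0r normrN ger0_norm ?exprn_ge0// => h.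
  by exists M.
have e2 : 0 < e / 2 by rewrite divr_gt0.
have sDv r : csig setT (deviant (e / 2) r 0) by exact: sig_deviant.
have dDv n m : (n <= m)%N -> deviant (e / 2) m 0 `<=` deviant (e / 2) n 0.
  by move=> nm eta [a0 [x [mx nt]]]; split=> //; exists x; split=> //; exact: leq_trans mx.
have dM : 0 < delta / 2 / M.+1%:R by rewrite !divr_gt0.
have [N hN] := law_bigcap_cvg0 mY sDv dDv (Ydeviant e2) _ dM.
exists (maxn M.+1 N) => h; rewrite geq_max => /andP[hM1 hN1].
have dh : (h <= d * h)%N by rewrite leq_pmull.
(* Since [M < h], these sites have norm between [2 d h] and [3 d h], hence lie between [d h] and
   [4 d h] from every point within [d h] of the origin. *)
pose F := [seq axis (2 * (d * h) + i) | i <- iota 0 M].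
have sF : size F = M by rewrite size_map size_iota.
have uF : uniq F by rewrite map_inj_uniq ?iota_uniq// => i j /axis_inj /addnI.
have hF p : p \in F -> forall y, (nrm y <= d * h)%N ->
     (d * h <= nrm (y - p) <= 4 * (d * h))%N.
  move=> /mapP[i]; rewrite mem_iota => iM -> y yh.
  have := nrm_tri (axis (2 * (d * h) + i)) y 0; rewrite !subr0 nrm_axis (nrmB _ y).
  have := nrm_tri y 0 (axis (2 * (d * h) + i)); rewrite !sub0r subr0 nrmN nrm_axis.
  set a := nrm (_ - _); lia.
pose V : set cfg := [set eta | forall p : lat d, p \in F -> cfg_om eta p = 0%N].
pose D p : set cfg := deviant (e / 2) (d * h) p.
have sV : csig setT V.
  apply: sig_all => p; have [pF|pF] := boolP (p \in F); last first.
    by rewrite (_ : [set _ | _] = setT); [exact: sigT|apply/seteqP].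
  rewrite (_ : [set _ | _] = [set eta | cfg_om eta p = 0%N]); first exact: sig_om.
  by apply/seteqP; split=> eta /=; [apply|].
have sD : csig setT [set eta | exists2 p : lat d, p \in F & D p eta].
  rewrite (_ : [set _ | _] = [set eta | exists p : lat d, p \in F /\ D p eta]).
    by apply: sig_ex => p; apply: sig_guard => _; exact: sig_deviant.
  by apply/seteqP; split=> eta [p]; [move=> a b|case=> a b]; exists p.
apply: (@le_trans _ _ (law P Y (V `|` [set eta | exists2 p : lat d, p \in F & D p eta]))).
  apply: law_mono => //; first by apply: (sigW _ (@sig_fast e H h 0 (ltW e0))).
    exact: sigU.
  move=> eta hf; apply: (fast_deviant e01 hH _ hF hf).
  exact: leq_trans hM1.
apply: le_trans (lawU mY sV sD) _.
rewrite [leRHS]splitr; apply: lerD.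
  by apply: le_trans (Yvacant uF) _; rewrite sF.
apply: (@le_trans _ _ ((size F)%:R * (delta / 2 / M.+1%:R))).
  apply: (law_ex_le mY F (fun p eta => D p eta)) => //.
    by move=> p; exact: sig_deviant.
  move=> p pF.
  rewrite (_ : [set eta | D p eta] = deviant (e / 2) (d * h) p)// shift_deviant.
  rewrite (Yshift p (A := deviant (e / 2) (d * h) 0)); last exact: sig_deviant.
  by apply: hN; exact: leq_trans dh.
rewrite sF mulrA ler_pdivrMr// mulrC ler_wpM2l ?ler_nat//.
by rewrite divr_ge0// ltW.
Qed.

End FastBoxes.

(** * Cutting a chain into legs; cells, their paths and their colours *)

Lemma last_exit (d : nat) (B : pred (lat d)) x (p : seq (lat d * nat)) :
  has B (x :: map fst p) -> ~~ B (pend x p) ->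
  exists p1 v k p2, [/\ p = p1 ++ (v, k) :: p2, B (pend x p1) &
    ~~ has B (v :: map fst p2)].
Proof.
elim: p x => [|[v k] p IH] x /=; first by rewrite orbF /pend /= => ->.
rewrite -/(pend v p) => hB ep.
have [hp|hp] := boolP (has B (v :: map fst p)).
  have [p1 [u [j [p2 [-> b1 b2]]]]] := IH v hp ep.
  by exists ((v, k) :: p1), u, j, p2.
exists [::], v, k, p; split=> //=.
by move: hB; rewrite -/(has B (v :: map fst p)) (negbTE hp) orbF.
Qed.

Section Decomposition.
Variable d : nat.
Local Notation idx := (lat d + (lat d * nat * nat))%type.
Local Notation val := (nat + lat d)%type.
Local Notation cfg := (idx -> val).

Fixpoint steps (h : nat) (x : lat d) (p : seq (lat d * nat)) : Prop :=
  if p is (v, k) :: p' then (nrm (v - x) <= h)%N /\ steps h v p' else True.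

Fixpoint legs (eta : cfg) (K : nat) (x : lat d) (s : seq (lat d * nat)) : Prop :=
  if s is (y, t) :: s' then
    [/\ reach eta x y t, (K < nrm (y - x))%N, (nrm (y - x) <= 2 * K)%N & legs eta K y s']
  else True.

Lemma steps_cat h x p q : steps h x (p ++ q) <-> steps h x p /\ steps h (pend x p) q.
Proof.
elim: p x => [|[v k] p IH] x /=; first by split=> [|[]].
by rewrite IH /pend /=; split=> [[? []]|[[]]].
Qed.

(* Each new leg starts at the first site visited after the last visit to the
   ball of radius [K] about the previous one, so the sites are [K]-separated. *)
Lemma chain_legs (eta : cfg) h K x p : (h <= K)%N -> slow x p -> chain eta x p -> steps h x p ->
  exists s, [/\ legs eta K x s, (ptime s <= ptime p)%N, (nrm (pend x p - pend x s) <= K)%N,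
    {subset map fst s <= map fst p} & pairwise (fun u v => K < nrm (v - u))%N (x :: map fst s)].
Proof.
move=> hK; have [n] := ubnP (size p); elim: n x p => // n IH x p pn sp cp tp.
have [near_end|far] := boolP (nrm (pend x p - x) <= K)%N.
  by exists [::]; split=> //.
pose B : pred (lat d) := fun v => (nrm (v - x) <= K)%N.
have hB : has B (x :: map fst p) by rewrite /= /B subrr nrm0.
have [p1 [v [k [p2 [e b1 b2]]]]] := last_exit hB far.
move: sp cp tp pn; rewrite e => /slow_cat [sp1 [vk sp2]] /chain_cat [cp1 [hv cp2]].
move=> /steps_cat [_ [vh tp2]] pn.
have [|s [ls ts es ss ps]] := IH v p2 _ sp2 cp2 tp2.
  by move: pn; rewrite size_cat /=; lia.
have outside u : u \in v :: map fst p2 -> (K < nrm (u - x))%N.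
  by move=> uin; rewrite ltnNge; apply: contra b2 => ub; apply/hasP; exists u.
exists ((v, (ptime p1 + k)%N) :: s); split=> /=.
- split=> //.
  + apply: reach_trans; first by exists p1.
    by exists [:: (v, k)]; rewrite /ptime /= addn0.
  + by apply: outside; rewrite mem_head.
  (* The last site inside the ball is within [K] of the centre, and the exit hop adds at most
     [h <= K]. *)
  + have := nrm_tri v (pend x p1) x; move: b1 vh; rewrite /B.
    move: (nrm (v - x)) (nrm (v - pend x p1)) (nrm (pend x p1 - x)) => a1 a2 a3; lia.
- by rewrite /ptime /= -!/(ptime _) ptime_cat /ptime /= -!/(ptime _); lia.
- by rewrite pend_cat.
- move=> u; rewrite map_cat mem_cat !inE => /orP[/eqP ->|/ss ->]; first by rewrite eqxx orbT.
  by rewrite !orbT.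
- rewrite -/(pairwise _ (v :: map fst s)) ps andbT outside ?mem_head//=.
  apply/allP => u /ss us; apply: outside; by rewrite inE us orbT.
Qed.

(** Candidates for the fast cells along a cell path: each visited cell is dropped or kept, whence
    the factor 2 in the count. With [0] in [st], shorter paths are padded by standing still. *)
Fixpoint samples (st : seq (lat d)) (Q : nat) (g : lat d) : seq (seq (lat d)) :=
  if Q is Q'.+1 then
    flatten [seq samples st Q' (g + v) ++ map (cons g) (samples st Q' (g + v)) | v <- st]
  else [:: [::]].

Lemma size_samples st Q g : size (samples st Q g) = ((2 * size st) ^ Q)%N.
Proof.
elim: Q g => [|Q IH] g //=; rewrite size_flatten /shape -map_comp.
rewrite (eq_map (g := fun=> (2 * (2 * size st) ^ Q)%N)); last first.
  by move=> v /=; rewrite size_cat size_map IH addnn -mul2n.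
rewrite expnS -mulnA mulnCA.
by elim: {2 3}st => //= v s ->; rewrite mulSn.
Qed.

Lemma mem_samples st Q g gs J : 0 \in st -> path (fun a b => b - a \in st) g gs ->
  (size gs < Q)%N -> subseq J (g :: gs) -> J \in samples st Q g.
Proof.
move=> st0.
have nil_in Q' g' : [::] \in samples st Q' g'.
  elim: Q' g' => [|Q' IH] g' //=; apply/flattenP; eexists; first exact: map_f st0.
  by rewrite mem_cat IH.
elim: Q g gs J => [|Q IH] g gs J //= pg sz sJ.
have in_samples v J' : v \in st -> J' \in samples st Q (g + v) ->
    (J' \in samples st Q.+1 g) * ((g :: J') \in samples st Q.+1 g).
  move=> vst J'in; split; apply/flattenP; (eexists; first exact: map_f vst);
    rewrite mem_cat ?J'in ?map_f ?orbT//.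
case: J sJ => [|j J] sJ; first exact: (nil_in Q.+1).
case: gs pg sz sJ => [|g1 gs].
  move=> _ _; rewrite subseq0; have [-> /eqP ->|_ //] := eqVneq j g.
  by apply: (in_samples 0 _ st0 _).2; exact: nil_in.
rewrite /=.
move=> /andP[g1st pg] sz; case: eqP => [-> sJ|_ sJ].
  apply: (in_samples (g1 - g) _ g1st _).2; rewrite addrC subrK.
  by apply: (IH g1 gs).
have [|h1 _] := in_samples (g1 - g) (j :: J) g1st; last exact: h1.
by rewrite addrC subrK; apply: (IH g1 gs).
Qed.

Lemma pigeonhole (T : eqType) (C : finType) (a : pred T) (col : T -> C) (L : seq T) :
  (0 < #|C|)%N ->
  exists c, (count a L <= #|C| * count (fun x => a x && (col x == c)) L)%N.
Proof.
move=> C0.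
have hs : count a L = (\sum_(c : C) count (fun x => a x && (col x == c)) L)%N.
  elim: L => [|x L IH] /=; first by rewrite big1.
  rewrite big_split /= -IH; congr (_ + _)%N.
  rewrite (bigD1 (col x))//= eqxx andbT big1 ?addn0// => c /negbTE cx.
  by rewrite eq_sym cx andbF.
have [c hc] := bigop.eq_bigmax (fun c => count (fun x => a x && (col x == c)) L) C0.
exists c; rewrite hs -hc -sum_nat_const; apply: leq_sum => c' _.
exact: bigop.leq_bigmax.
Qed.

Lemma coordB (a b : lat d) i : (a - b) 0 i = a 0 i - b 0 i.
Proof. by rewrite !mxE. Qed.

Definition cell (h : nat) (y : lat d) : lat d := \row_i (y 0%R i %/ h%:Z)%Z.
Definition corner (h : nat) (g : lat d) : lat d := \row_i (g 0 i * h%:Z).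

Lemma cell0 h : cell h 0 = 0.
Proof. by apply/rowP => i; rewrite !mxE div0z. Qed.

Lemma cell_corner h (y : lat d) i : (0 < h)%N ->
  (0 <= y 0 i - corner h (cell h y) 0 i < h%:Z)%R.
Proof.
move=> h0; rewrite !mxE.
have := divz_eq (y 0 i) h%:Z; have := modz_ge0 (y 0 i) (_ : h%:Z != 0).
have := ltz_pmod (y 0 i) (_ : 0 < h%:Z).
set q := (_ %/ _)%Z; set m := (_ %% _)%Z => h1 h2 ->.
have {}h1 := h1 (_ : 0 < h%:Z); rewrite addrAC subrr add0r h1 ?h2//; lia.
Qed.

Lemma nrm_cell_corner h (y : lat d) : (0 < h)%N -> (nrm (y - corner h (cell h y)) <= d * h)%N.
Proof.
move=> h0; apply: nrm_leq => i; have := cell_corner y i h0.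
by rewrite coordB; set a := (_ - _); lia.
Qed.

Lemma cell_step h r (y y' : lat d) : (0 < h)%N -> (nrm (y' - y) <= r * h)%N ->
  cell h y' - cell h y \in cube d r.+1.
Proof.
move=> h0 hr; apply: mem_cube => i.
have := leq_trans (nrm_coord (y' - y) i) hr.
have := cell_corner y i h0; have := cell_corner y' i h0.
rewrite [corner _ _ 0 i]mxE [corner _ (cell h y) 0 i]mxE.
rewrite !coordB.
move: (cell h y' 0 i) (cell h y 0 i) (y' 0 i) (y 0 i) => a b u v.
nia.
Qed.

Lemma cell_inj h (y y' : lat d) : (0 < h)%N -> cell h y = cell h y' -> (nrm (y - y') <= d * h)%N.
Proof.
move=> h0 e; apply: nrm_leq => i.
have := cell_corner y i h0; have := cell_corner y' i h0; rewrite e.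
rewrite !coordB.
move: (corner _ _ 0 i) (y' 0 i) (y 0 i) => a b u; lia.
Qed.

Definition colour (s : nat) (g : lat d) : {ffun 'I_d -> 'I_s.+1} :=
  [ffun i => inord (absz (g 0%R i %% s.+1%:Z)%Z)].

(** Cells with equal residues modulo [s.+1] differ by a nonzero multiple of [s.+1] in some
    coordinate, so their corners are at least [s.+1 * h] apart. *)
Lemma colour_far s h L (g g' : lat d) : (2 * L < s.+1 * h)%N -> colour s g = colour s g' -> g != g' ->
  around (corner h g) L `&` around (corner h g') L = set0.
Proof.
move=> hL /ffunP ec gg'; apply/seteqP; split=> // i []; rewrite /around /= => n1 n2.
have h0 : (0 < h)%N by lia.
have [j hj] : exists j, g 0 j <> g' 0 j.
  apply: contrapT => hn; move/eqP: gg'; apply; apply/rowP => j.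
  by apply: contrapT => hj; apply: hn; exists j.
have s0 : (s.+1%:Z != 0) by [].
have sp : 0 < s.+1%:Z :> int by [].
have em : (g 0%R j %% s.+1%:Z)%Z = (g' 0%R j %% s.+1%:Z)%Z.
  have := ec j; rewrite !ffunE => /(congr1 (@nat_of_ord _)) /=.
  have := ltz_pmod (g 0 j) sp; have := modz_ge0 (g 0 j) s0.
  have := ltz_pmod (g' 0 j) sp; have := modz_ge0 (g' 0 j) s0.
  move: (g 0%R j %% _)%Z (g' 0%R j %% _)%Z => m m' m'0 m's m0 ms.
  by rewrite !inordK; lia.
have dist : (s.+1 <= absz (g 0%R j - g' 0%R j)%R)%N.
  move: hj; rewrite (divz_eq (g 0 j) s.+1%:Z) (divz_eq (g' 0 j) s.+1%:Z) em.
  set q := (_ %/ _)%Z; set q' := (_ %/ _)%Z; set m := (_ %% _)%Z => hj.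
  rewrite opprD addrACA subrr addr0 -mulrBl abszM leq_pmull// absz_gt0 subr_eq0.
  by apply/eqP => qq; apply: hj; rewrite qq.
have := nrm_coord (corner h g - corner h g') j.
rewrite coordB ![corner _ _ 0 j]mxE -mulrBl abszM /= => nc.
have := nrm_tri (corner h g) (site i) (corner h g'); rewrite (nrmB _ (site i)) => tri.
have : (s.+1 * h <= absz (g 0%R j - g' 0%R j)%R * h)%N by rewrite leq_mul2r dist orbT.
move: nc tri n1 n2 hL; move: (absz _ * h)%N (nrm _) (nrm _) (nrm _) => a1 a2 a3 a4; lia.
Qed.

End Decomposition.

(** * An early arrival forces many independent fast cells *)

Section EarlyArrival.
Context (R : realType) (d : nat).
Local Notation idx := (lat d + (lat d * nat * nat))%type.
Local Notation val := (nat + lat d)%type.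
Local Notation cfg := (idx -> val).
Variable mu : lat d -> R.
Variable C : nat.
Hypothesis mu_ge0 : forall x, 0 <= mu x.
Hypothesis muD : forall x y, mu (x + y) <= mu x + mu y.
Hypothesis muN : forall x, mu (- x) = mu x.
Hypothesis muC : forall x, mu x <= C%:R * (nrm x)%:R.
Hypothesis C0 : (0 < C)%N.
Hypothesis hd : (0 < d)%N.

Definition fast_cell e H h (eta : cfg) (g : lat d) : bool :=
  `[< fast mu e H h (corner h g) eta >].

(** A leg from a cell that is not fast satisfies [mu <= t + e |leg| <= (1 + e) t], as speed is at
    most one. A leg from a fast cell is charged the trivial bound [2 C H h]. *)
Lemma legs_mu e H h (eta : cfg) x s : 0 <= e -> (0 < h)%N -> legs eta (H * h) x s ->
  mu (pend x s - x) <= (1 + e) * (ptime s)%:R +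
    2 * C%:R * (H * h)%:R * (count (fast_cell e H h eta) (map (cell h) (x :: map fst s)))%:R.
Proof.
move=> e0 h0; elim: s x => [|[y t] s IH] x.
  move=> _; rewrite /pend /= subrr; apply: le_trans (muC 0) _.
  by rewrite nrm0 mulr0 addr_ge0 ?mulr_ge0 ?addr_ge0.
move=> [r lo hi ls].
have {IH ls} := IH y ls.
rewrite (_ : count _ (map (cell h) (x :: _)) = (fast_cell e H h eta (cell h x) +
  count (fast_cell e H h eta) (map (cell h) (y :: map fst s)))%N)//.
rewrite (_ : ptime ((y, t) :: s) = (t + ptime s)%N)// !natrD.
set n := (count _ _)%:R => IH.
have tri : mu (pend y s - x) <= mu (pend y s - y) + mu (y - x).
  by have := muD (pend y s - y) (y - x); rewrite addrA subrK.
have yx : (nrm (y - x))%:R <= t%:R :> R by rewrite ler_nat; exact: reach_nrm r.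
rewrite [pend x _]/(pend y s).
have [fx|/negbTE nfx] := boolP (fast_cell e H h eta (cell h x)).
  rewrite (_ : true%:R = 1 :> R)//.
  have : mu (y - x) <= 2 * C%:R * (H * h)%:R.
    apply: le_trans (muC _) _; rewrite [2 * _]mulrC -mulrA ler_wpM2l//.
    by rewrite -natrM ler_nat.
  have : 0 <= (1 + e) * t%:R by rewrite mulr_ge0 ?addr_ge0.
  lra.
rewrite (_ : false%:R = 0 :> R)//.
have : mu (y - x) <= (1 + e) * t%:R.
  have [|tl] := leP (mu (y - x) - e * (nrm (y - x))%:R) t%:R.
    have : e * (nrm (y - x))%:R <= e * t%:R by rewrite ler_wpM2l.
    lra.
  move: nfx; rewrite /fast_cell => /asboolP; case; exists (x, y, t); split=> //; split=> //.
  exact: nrm_cell_corner.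
lra.
Qed.

Lemma legs_size (eta : cfg) K x s : legs eta K x s -> (size s * K <= ptime s)%N.
Proof.
elim: s x => [|[y t] s IH] x //= [r lo hi /IH].
rewrite mulSn /ptime /= -/(ptime s) => h; apply: leq_add => //.
exact: leq_trans (ltnW lo) (reach_nrm r).
Qed.

Lemma legs_path (eta : cfg) H h x s : (0 < h)%N -> legs eta (H * h) x s ->
  path (fun a b => b - a \in cube d (2 * H).+1) (cell h x) (map (cell h) (map fst s)).
Proof.
move=> h0; elim: s x => [|[y t] s IH] x //= [r lo hi ls].
by rewrite IH// andbT; apply: cell_step => //; rewrite -mulnA.
Qed.

Lemma separated_cells H h (L : seq (lat d)) : (0 < h)%N -> (d <= H)%N ->
  pairwise (fun u v => H * h < nrm (v - u))%N L -> uniq (map (cell h) L).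
Proof.
move=> h0 dH; rewrite uniq_pairwise pairwise_map; apply: sub_pairwise => u v /= uv.
apply/eqP => e; have := cell_inj h0 (esym e).
by rewrite leqNgt (leq_ltn_trans _ uv)// leq_mul2r dH orbT.
Qed.

Definition reach_radius H h := ((d + 2 * C * H) * h)%N.

Definition separated H h (J : seq (lat d)) : Prop :=
  forall g g', g \in J -> g' \in J -> g != g' ->
    around (corner h g) (reach_radius H h) `&` around (corner h g') (reach_radius H h) = set0.

Definition crowded e H h Q b : set cfg :=
  [set eta | exists2 J, J \in samples (cube d (2 * H).+1) Q 0 &
    [/\ uniq J, separated H h J & (b <= size J)%N] /\
    forall g, g \in J -> fast mu e H h (corner h g) eta].

(** The number of colours for the modulus [s.+1] with [s = 2 (d + 2 C H)]. Then [s * h] is twice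
    [reach_radius], just below the threshold in [colour_far]. *)
Definition colours H := ((2 * (d + 2 * C * H)).+1 ^ d)%N.

(** Since [(1 + eps/2)(1 - eps) <= 1 - eps/2], the legs leave a deficit [eps/2 * mu] that only fast
    cells and the final piece of length at most [H h] can cover. This forces [colours H * b] fast
    cells, and one colour class contains [b] of them. *)
Lemma early_crowded eps H h Q b (eta : cfg) p : 0 < eps <= 1 -> (0 < h)%N ->
  (d <= H)%N ->
  slow 0 p -> chain eta 0 p -> steps h 0 p ->
  (ptime p)%:R <= (1 - eps) * mu (pend 0 p) ->
  (ptime p < Q * (H * h))%N ->
  2 * C%:R * (H * h)%:R * (colours H * b)%:R + C%:R * (H * h)%:R <= eps / 2 * mu (pend 0 p) ->
  crowded (eps / 2) H h Q b eta.
Proof.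
move=> /andP[eps0 eps1] h0 dH sp cp tp time short big_mu.
have H0 : (0 < H)%N by exact: leq_trans dH.
have hK : (h <= H * h)%N by rewrite leq_pmull.
have [s [ls ts es _ ps]] := chain_legs hK sp cp tp.
have e0 : 0 <= eps / 2 by rewrite divr_ge0// ltW.
have lm := legs_mu e0 h0 ls; move: lm.
set L := map (cell h) (0 :: map fst s).
set a := fast_cell _ _ _ _ => lm.
have uL : uniq L by apply: separated_cells ps.
have [c hc] := pigeonhole a (colour (2 * (d + 2 * C * H))) L
  (C := {ffun 'I_d -> 'I_(2 * (d + 2 * C * H)).+1}) ltac:(by rewrite card_ffun !card_ord expn_gt0).
pose J := [seq g <- L | a g && (colour (2 * (d + 2 * C * H)) g == c)].
exists J.
  apply: (@mem_samples _ _ _ _ (map (cell h) (map fst s))).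
  - by apply: mem_cube_nrm; rewrite nrm0.
  - by have := legs_path h0 ls; rewrite cell0.
  - rewrite !size_map.
    have KQ : (size s * (H * h) < Q * (H * h))%N.
      apply: leq_ltn_trans short; apply: leq_trans ts; exact: legs_size ls.
    by move: KQ; rewrite ltn_mul2r => /andP[].
  - have <- : L = 0 :: map (cell h) (map fst s) by rewrite /L [map _ (_ :: _)]/= cell0.
    exact: filter_subseq.
split; last by move=> g; rewrite mem_filter => /andP[/andP[/asboolP]].
split.
- exact: filter_uniq.
- move=> g g'; rewrite !mem_filter => /andP[/andP[_ /eqP cg] _] /andP[/andP[_ /eqP cg'] _].
  apply: (@colour_far _ (2 * (d + 2 * C * H))); last by rewrite cg cg'.
  by rewrite /reach_radius mulnA ltn_pmul2r.
rewrite size_filter -(@leq_pmul2l (colours H)) ?expn_gt0//.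
apply: (@leq_trans (count a L)); last first.
  by move: hc; rewrite card_ffun !card_ord.
have K0 : 0 < 2 * C%:R * (H * h)%:R :> R.
  by rewrite !mulr_gt0 ?ltr0n ?muln_gt0 ?H0.
rewrite -(ler_nat R) -(ler_pM2l K0).
rewrite subr0 in lm.
have tri : mu (pend 0 p) <= mu (pend 0 s) + C%:R * (H * h)%:R.
  rewrite -[pend 0 p](subrK (pend 0 s)) addrC; apply: le_trans (muD _ _) _.
  rewrite lerD2l; apply: le_trans (muC _) _; rewrite ler_wpM2l// ler_nat//.
have tle : (1 + eps / 2) * (ptime s)%:R <= (1 - eps / 2) * mu (pend 0 p).
  apply: (@le_trans _ _ ((1 + eps / 2) * ((1 - eps) * mu (pend 0 p)))).
    rewrite ler_wpM2l ?addr_ge0//; apply: le_trans time; by rewrite ler_nat.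
  rewrite mulrA ler_wpM2r//; nra.
lra.
Qed.

Lemma sig_crowded e H h Q b : 0 <= e -> csig setT (crowded e H h Q b).
Proof.
move=> e0.
rewrite (_ : crowded _ _ _ _ _ = [set eta | exists J, (J \in samples (cube d (2 * H).+1) Q 0 /\
    [/\ uniq J, separated H h J & (b <= size J)%N]) /\
    forall g, g \in J -> fast mu e H h (corner h g) eta]).
  apply: sig_ex => J; apply: sig_guard => _; apply: sig_all => g.
  have [gJ|gJ] := boolP (g \in J); last first.
    by rewrite (_ : [set _ | _] = setT); [exact: sigT|apply/seteqP].
  rewrite (_ : [set _ | _] = fast mu e H h (corner h g)).
    by apply: (sigW _ (@sig_fast R d mu C muC e H h (corner h g) e0)).
  by apply/seteqP; split=> eta /=; [apply|].
by apply/seteqP; split=> eta [J]; [move=> ? []|move=> [[? ?] ?]]; exists J.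
Qed.

Context (dm : measure_display) (Om : measurableType dm) (P : probability Om R).
Variable Y : Om -> cfg.
Hypothesis mY : measY Y.
Hypothesis Yindep : cyl_indep P Y.
Hypothesis Yshift : forall c (A : set cfg), csig setT A ->
  law P Y [set eta | A (shift_cfg c eta)] = law P Y A.

Lemma law_crowded e H h Q b delta : 0 <= e -> delta <= 1 ->
  law P Y (fast mu e H h 0) <= delta ->
  law P Y (crowded e H h Q b) <= ((2 * ((2 * H).+1.*2.+1) ^ d) ^ Q)%:R * delta ^+ b.
Proof.
move=> e0 d1 hfast.
have d0 : 0 <= delta by apply: le_trans hfast; exact: law_ge0.
rewrite -size_cube -(size_samples _ Q 0).
apply: (law_ex_le mY _ (fun J eta => [/\ uniq J, separated H h J & (b <= size J)%N] /\
    forall g, g \in J -> fast mu e H h (corner h g) eta)) => //.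
- exact: sig_crowded.
- move=> J; apply: sig_guard => _; apply: sig_all => g.
  have [gJ|gJ] := boolP (g \in J); last first.
    by rewrite (_ : [set _ | _] = setT); [exact: sigT|apply/seteqP].
  rewrite (_ : [set _ | _] = fast mu e H h (corner h g)).
    by apply: (sigW _ (@sig_fast R d mu C muC e H h (corner h g) e0)).
  by apply/seteqP; split=> eta /=; [apply|].
move=> J _; have [[uJ sJ bJ]|nJ] := pselect [/\ uniq J, separated H h J & (b <= size J)%N]; last first.
  rewrite (_ : [set _ | _] = set0) ?law0 ?exprn_ge0//.
  by apply/seteqP; split=> // eta [].
rewrite (_ : [set _ | _] = \big[setI/setT]_(g <- J) fast mu e H h (corner h g)); last first.
  rewrite -bigcap_seq; apply/seteqP; split=> eta /=; first by case=> _ hg g gJ; exact: hg.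
  by move=> hg; split=> // g gJ; exact: hg.
rewrite (law_bigI mY Yindep (J := fun g => around (corner h g) (reach_radius H h)))//; last first.
  by move=> g; exact: sig_fast.
apply: (@le_trans _ _ (delta ^+ size J)); last by apply: ler_wiXn2l.
elim: (J) => [|g J' IH]; first by rewrite big_nil.
rewrite big_cons exprS /= ler_pM ?law_ge0 ?prodr_ge0//.
  by move=> g' _; exact: law_ge0.
by rewrite (law_fast_shift muC Yshift).
Qed.

End EarlyArrival.

(** * The union bound and the choice of constants *)

Lemma law_ex_null (R : realType) (I V : choiceType) (dm : measure_display)
  (Om : measurableType dm) (P : probability Om R) (Y : Om -> I -> V)
  (U : countType) (F : U -> (I -> V) -> Prop) :
  measY Y -> (forall u, csig setT [set eta | F u eta]) ->
  (forall u, law P Y [set eta | F u eta] = 0) -> law P Y [set eta | exists u, F u eta] = 0.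
Proof.
move=> mY sF hF; apply/eqP; rewrite eq_le law_ge0 andbT.
pose G n : set (I -> V) := [set eta | if unpickle n is Some u then F u eta else False].
have -> : [set eta | exists u, F u eta] = \bigcup_n G n.
  apply/seteqP; split=> eta /=.
    by move=> [u Fu]; exists (pickle u) => //; rewrite /G /= pickleK.
  by move=> [n _]; rewrite /G /=; case: (unpickle n) => // u Fu; exists u.
apply: (law_bigcup_le mY) => n.
  by rewrite /G; case: (unpickle n) => [u|]; [exact: sF|exact: sig_cst].
rewrite big1// => i _; rewrite /G; case: (unpickle i) => [u|]; first exact: hF.
by rewrite (_ : [set _ | False] = set0) ?law0//; apply/seteqP.
Qed.

(** Absorbs polynomial factors: [z <= expR z] at [z = c * y / N], raised to the power [N]. *)
Lemma pow_le_expR (R : realType) (c y : R) (N : nat) : 0 < c -> 0 <= y -> (0 < N)%N ->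
  y ^+ N <= (N%:R / c) ^+ N * expR (c * y).
Proof.
move=> c0 y0 N0; have N0' : 0 < N%:R :> R by rewrite ltr0n.
have -> : y ^+ N = (N%:R / c) ^+ N * (c * y / N%:R) ^+ N.
  by rewrite -exprMn; congr (_ ^+ _); field; lra.
have -> : expR (c * y) = expR (c * y / N%:R) ^+ N.
  by rewrite -expRM_natl; congr expR; field; lra.
have z0 : 0 <= c * y / N%:R by rewrite divr_ge0// mulr_ge0// ltW.
apply: ler_wpM2l; first by rewrite exprn_ge0// divr_ge0// ltW.
apply: lerXn2r; rewrite ?nnegrE ?expR_ge0//.
by apply: le_trans (expR_ge1Dx _); rewrite lerDr.
Qed.

Lemma cube_succ_le m : (0 < m)%N -> (m.+1 ^ 3 <= 8 * m ^ 3)%N.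
Proof.
move=> m0; have h : (m.+1 ^ 3 <= (2 * m) ^ 3)%N by rewrite leq_exp2r// mul2n -addnn -addn1 leq_add2l.
by apply: leq_trans h _; rewrite expnMn leq_mul2r orbC.
Qed.

Lemma double_mul8_le z : (0 < z)%N -> ((8 * z).*2.+1 <= 17 * z)%N.
Proof. lia. Qed.

Lemma succ_mul8_le C m : (0 < C * m)%N -> ((8 * C * m).+1 <= 9 * C * m)%N.
Proof. by rewrite -!mulnA; move: (C * m)%N => z; lia. Qed.

Section StretchedExponential.
Context (R : realType) (d : nat).
Local Notation idx := (lat d + (lat d * nat * nat))%type.
Local Notation val := (nat + lat d)%type.
Local Notation cfg := (idx -> val).
Variable mu : lat d -> R.
Variable C : nat.
Hypothesis mu_ge0 : forall x, 0 <= mu x.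
Hypothesis muD : forall x y, mu (x + y) <= mu x + mu y.
Hypothesis muN : forall x, mu (- x) = mu x.
Hypothesis muC : forall x, mu x <= C%:R * (nrm x)%:R.
Hypothesis C0 : (0 < C)%N.
Hypothesis hd : (0 < d)%N.

Definition unit_steps : set cfg :=
  [set eta | forall xlk : lat d * nat * nat, exists ib, eta (inr xlk) = inr (unitv ib)].

Lemma unit_walk (eta : cfg) u l k : unit_steps eta -> (nrm (cfg_walk eta u l k) <= k)%N.
Proof.
move=> h; rewrite /cfg_walk; elim: k => [|k IH]; first by rewrite big_ord0 nrm0.
rewrite big_ord_recr /=; apply: leq_trans (nrmD _ _) _.
have [ib e] := h (u, l, k).
by rewrite /cfg_inc e nrm_unitv addn1 ltnS.
Qed.

Lemma chain_slow (eta : cfg) x p : unit_steps eta -> chain eta x p -> slow x p.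
Proof.
move=> h; elim: p x => [|[v k] p IH] x //= [[l [_ <-]] c]; split; last exact: IH.
by rewrite addrAC subrr add0r unit_walk.
Qed.

(** By slowness every hop starts within [t] of the origin and lasts at most [t], so finitely many
    starting sites have to be checked for jumps. *)
Lemma chain_steps (eta : cfg) t h x p : chain eta x p -> slow x p ->
  (nrm x + ptime p <= t)%N -> (forall u, (nrm u <= t)%N -> ~ jump t h u eta) ->
  steps h x p.
Proof.
move=> + + + nj; elim: p x => [|[v k] p IH] x //= [[l [lo e]] c] [vk s].
rewrite /ptime /= -/(ptime p) => le.
have xt : (nrm x <= t)%N by lia.
split.
  have -> : v - x = cfg_walk eta x l k by rewrite -e addrAC subrr add0r.
  rewrite leqNgt; apply/negP => hlt; apply: (nj x xt); exists l, k; split=> //; last exact: ltnW.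
  lia.
apply: IH => //; have := nrmD (v - x) x; rewrite subrK; lia.
Qed.

(** Unlike [reach] this does not ask for [slow], so for [x] other than the origin it is exactly
    [T(0,x) <= a]. Slowness is recovered on [unit_steps]. *)
Definition early (a : R) (x : lat d) : set cfg :=
  [set eta | exists p, [/\ pend 0 p = x & (ptime p)%:R <= a] /\ chain eta 0 p].

Lemma sig_early a x : csig setT (early a x).
Proof. by apply: sig_ex => p; apply: sig_guard => _; apply: sig_chain. Qed.

Context (dm : measure_display) (Om : measurableType dm) (P : probability Om R).
Variable Y : Om -> cfg.
Hypothesis mY : measY Y.
Hypothesis Yindep : cyl_indep P Y.
Hypothesis Yshift : forall c (A : set cfg), csig setT A ->
  law P Y [set eta | A (shift_cfg c eta)] = law P Y A.
Hypothesis Ystep : forall x l k ib,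
  law P Y [set eta : cfg | eta (inr (x, l, k)) = inr (unitv ib)] = (2 * d)%:R^-1.
Hypothesis Yunit : forall x l k,
  law P Y [set eta : cfg | exists ib, eta (inr (x, l, k)) = inr (unitv ib)] = 1.

Lemma sig_unit_steps : csig setT unit_steps.
Proof. by apply: sig_all => -[[x l] k]; apply: sig_ex => ib; exact: sig_eq. Qed.

Lemma law_unit_steps : law P Y (~` unit_steps) = 0.
Proof.
have s1 (xlk : lat d * nat * nat) :
    csig setT [set eta : cfg | exists ib, eta (inr xlk) = inr (unitv ib)].
  by apply: sig_ex => ib; exact: sig_eq.
have -> : ~` unit_steps = [set eta | exists xlk : lat d * nat * nat,
    ~ exists ib, eta (inr xlk) = inr (unitv ib)].
  by apply/seteqP; split=> eta /=; [move/existsNP|move=> h; apply/existsNP].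
apply: law_ex_null => //; first by move=> xlk; exact: sigC (s1 xlk).
move=> [[x l] k]; have := lawC (P:=P) mY (s1 (x, l, k)).
by rewrite Yunit subrr.
Qed.

Lemma law_early eps H h Q b t (B delta : R) x : 0 < eps <= 1 -> (0 < h)%N -> (d <= H)%N ->
  mu x <= t%:R -> (t < Q * (H * h))%N ->
  2 * C%:R * (H * h)%:R * (colours d C H * b)%:R + C%:R * (H * h)%:R <= eps / 2 * mu x ->
  (forall u, law P Y (jump t h u) <= B) ->
  delta <= 1 -> law P Y (fast mu (eps / 2) H h 0) <= delta ->
  law P Y (early ((1 - eps) * mu x) x) <=
  (t.*2.+1 ^ d)%:R * B + ((2 * ((2 * H).+1.*2.+1) ^ d) ^ Q)%:R * delta ^+ b.
Proof.
move=> eps01 h0 dH mt tQ big_mu hB d1 hfast; have /andP[eps0 eps1] := eps01.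
have e0 : 0 <= eps / 2 by rewrite divr_ge0// ltW.
pose U := ~` unit_steps.
pose J : set cfg := [set eta | exists2 u, u \in cube d t & jump t h u eta].
pose W : set cfg := crowded mu C (eps / 2) H h Q b.
have sU : csig setT U by apply: sigC; exact: sig_unit_steps.
have sJ : csig setT J.
  rewrite (_ : J = [set eta | exists u, u \in cube d t /\ jump t h u eta]).
    by apply: sig_ex => u; apply: sig_guard => _; exact: sig_jump.
  by apply/seteqP; split=> eta [u]; [move=> a a'|case=> a a']; exists u.
have sW : csig setT W by exact: sig_crowded.
have sub : early ((1 - eps) * mu x) x `<=` U `|` (J `|` W).
  move=> eta [p [[px pt] cp]].
  have [uns|] := pselect (unit_steps eta); last by left.
  have [?|nJ] := pselect (J eta); [by right; left|right; right].
  have sp := chain_slow uns cp.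
  have ptt : (ptime p <= t)%N.
    rewrite -(ler_nat R); apply: le_trans pt _; apply: le_trans mt.
    by rewrite ler_piMl// gerBl ltW.
  have st : steps h 0 p.
    apply: (chain_steps cp sp (t := t)); first by rewrite nrm0.
    by move=> u ut ju; apply: nJ; exists u => //; exact: mem_cube_nrm.
  subst x; apply: (early_crowded mu_ge0 muD muC C0 hd eps01 h0 dH sp cp st pt _ big_mu).
  exact: leq_ltn_trans ptt tQ.
apply: le_trans (law_mono mY (sig_early _ _) (sigU sU (sigU sJ sW)) sub) _.
apply: le_trans (lawU mY sU (sigU sJ sW)) _.
rewrite law_unit_steps add0r; apply: le_trans (lawU mY sJ sW) _.
apply: lerD; last exact: law_crowded.
rewrite -size_cube; apply: (law_ex_le mY _ (fun u eta => jump t h u eta)) => // u; first exact: sig_jump.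
by move=> _; exact: hB.
Qed.

Variable zeta : R.
Hypothesis zeta01 : 0 <= zeta < 1.
Hypothesis Yvacant : forall F : seq (lat d), uniq F ->
  law P Y [set eta | forall p : lat d, p \in F -> cfg_om eta p = 0%N] <= zeta ^+ size F.
Hypothesis Ydeviant : forall e, 0 < e -> law P Y (\bigcap_r deviant mu e r 0) = 0.
Variable Mom : R.
Hypothesis hMom : forall n, \sum_(l < n) law P Y [set eta : cfg | (l < cfg_om eta 0%R)%N] <= Mom.
Variable N0 : nat.
Hypothesis mu_low : forall x, (N0 <= nrm x)%N -> (nrm x)%:R / 2 <= mu x.

Lemma early_stretched eps : 0 < eps <= 1 -> exists A c : R, exists m0 : nat,
  [/\ 0 < A, 0 < c & forall m x, (m0 <= m)%N -> (m ^ 3 <= nrm x < m.+1 ^ 3)%N ->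
    law P Y (early ((1 - eps) * mu x) x) <= A * expR (- (c * m%:R))].
Proof.
move=> eps01; have /andP[eps0 eps1] := eps01.
have dR : 1 <= d%:R :> R by rewrite ler1n.
have CR : 1 <= C%:R :> R by rewrite ler1n.
(* The requirement of [law_fast_small] at [e = eps / 2]; it also gives [d <= H], which puts
   separated sites into distinct cells. *)
pose H := (Num.truncn (32 * d%:R * (C%:R + 1) / eps)).+1.
have HR : 32 * d%:R * (C%:R + 1) <= eps * H%:R.
  have : 32 * d%:R * (C%:R + 1) / eps < H%:R by rewrite truncnS_gt.
  by rewrite ltr_pdivrMr// [H%:R * _]mulrC => /ltW.
have H1 : (0 < H)%N by [].
have HR1 : 1 <= H%:R :> R by rewrite ler1n.
have dH : (d <= H)%N by rewrite -(ler_nat R); nra.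
pose S := colours d C H.
have S0 : (0 < S)%N by rewrite expn_gt0.
have SR : 1 <= S%:R :> R by rewrite ler1n.
pose D0 := (2 * ((2 * H).+1.*2.+1) ^ d)%N.
have D01 : (1 <= D0)%N by rewrite muln_gt0 expn_gt0.
have lnD : 0 <= ln (D0%:R : R) by rewrite ln_ge0// ler1n.
(* As [mu x >= m h / 2], the budget [eps/2 * mu x] is at least [eps m h / 4]. Half of it pays for
   [b <= c2 m] fast cells per colour, the other half for the final piece, once
   [m >= 8 C H / eps]. *)
pose c2 : R := eps / (16 * C%:R * H%:R * S%:R).
have CHS : 0 < 16 * C%:R * H%:R * S%:R :> R by rewrite !mulr_gt0 ?ltr0n.
have c20 : 0 < c2 by rewrite divr_gt0.
(* There are [D0 ^ Q] samples with [Q <= 9 C m], and [b > c2 m - 1]. With fast probability at most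
   [expR (- theta)] the product is at most [expR (theta - m)]; the prefactor [expR theta] pays for
   rounding [b]. *)
pose theta : R := (9 * C%:R * ln D0%:R + 1) / c2.
have theta0 : 0 <= theta.
  by rewrite divr_ge0 ?(ltW c20)// addr_ge0// !mulr_ge0.
have e2 : 0 < eps / 2 <= 1 by apply/andP; split; lra.
have hH2 : 16 * d%:R * (C%:R + 1) <= eps / 2 * H%:R by lra.
have [h0 hh0] := law_fast_small muD muN muC mY Yshift zeta01 Yvacant Ydeviant hd e2 hH2
  (expR_gt0 (- theta)).
have Mom0 : 0 <= Mom by have := hMom 0; rewrite big_ord0.
(* With [lam = kap / m], [t = 8 C m^3] and [h = m^2] the Chernoff exponent is
   [(16 C kap^2 - kap / d) m]. This [kap] minimizes it, with value [- c3 m]. *)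
pose kap : R := (32 * C%:R * d%:R)^-1.
have Cd0 : 0 < 32 * C%:R * d%:R :> R by rewrite !mulr_gt0 ?ltr0n.
have kap0 : 0 < kap by rewrite invr_gt0.
pose c3 : R := kap / (2 * d%:R).
have c30 : 0 < c3 by rewrite divr_gt0// mulr_gt0// ltr0n.
have kap1 : kap <= 32^-1.
  by rewrite lef_pV2 ?posrE// -mulrA ler_peMr//; nra.
(* The jump term decays at rate [c3 / 2] once half of its exponent has absorbed the polynomial, and
   the crowded term at rate 1. This lets them share the rate [c3 / 2]. *)
have c31 : c3 / 2 <= 1.
  rewrite /c3 -mulrA -invfM ler_pdivrMr ?mulr_gt0 ?ltr0n//; nra.
(* The degree in [m] of the factors in front of the jump probability: about [t ^ d] starting sites
   and [t.+1] times, with [t] of order [m^3]. *)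
pose N := (3 * d.+1)%N.
pose A1 : R := Mom * (2 * d)%:R * (17 * C%:R) ^+ d.+1 * (N%:R / (c3 / 2)) ^+ N.
have A10 : 0 <= A1.
  by rewrite !mulr_ge0 ?exprn_ge0 ?mulr_ge0 ?invr_ge0 ?divr_ge0 ?ler0n// ltW.
exists (A1 + expR theta), (c3 / 2), (maxn (maxn h0 N0) (Num.truncn (8 * C%:R * H%:R / eps)).+1).
split; [by rewrite ltr_wpDl// expR_gt0|by rewrite divr_gt0|].
move=> m x; rewrite !geq_max => /andP[/andP[mh0 mN0] meps] /andP[xlo xhi].
have m0 : (0 < m)%N by exact: leq_trans meps.
have mR : 1 <= m%:R :> R by rewrite ler1n.
have meps' : 8 * C%:R * H%:R <= eps * m%:R.
  have : 8 * C%:R * H%:R / eps < m%:R.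
    by apply: lt_le_trans (truncnS_gt _) _; rewrite ler_nat.
  by rewrite ltr_pdivrMr// [m%:R * _]mulrC => /ltW.
pose h := (m ^ 2)%N.
have hm : (m <= h)%N by rewrite /h expnS leq_pmulr// expn_gt0 m0.
(* From [(m+1)^3 <= 8 m^3] this dominates [C |x|], hence [mu x] and the time of any early chain. *)
pose t := (8 * C * m ^ 3)%N.
pose Q := (8 * C * m).+1.
pose b := Num.truncn (c2 * m%:R).
have cm0 : 0 <= c2 * m%:R by rewrite mulr_ge0// ltW.
have b1 : b%:R <= c2 * m%:R by rewrite truncn_le.
have b2 : c2 * m%:R < b%:R + 1 by rewrite natr1 truncnS_gt.
have nx : (m ^ 3)%:R <= (nrm x)%:R :> R by rewrite ler_nat.
have m3 : (m ^ 3)%:R = m%:R * (h%:R : R) by rewrite -natrM -expnS.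
have hR : h%:R = m%:R * m%:R :> R by rewrite -natrM.
have mux : m%:R * h%:R / 2 <= mu x.
  rewrite -m3; apply: le_trans (mu_low _); first by rewrite ler_pM2r ?invr_gt0.
  apply: leq_trans mN0 (leq_trans hm (leq_trans _ xlo)).
  by rewrite (expnS m 2) leq_pmull.
have h0' : (0 < h)%N by rewrite expn_gt0 m0.
have hR0 : 0 < h%:R :> R by rewrite ltr0n.
have mut : mu x <= t%:R.
  apply: le_trans (muC x) _; rewrite -natrM ler_nat.
  apply: (@leq_trans (C * m.+1 ^ 3)%N); first by rewrite leq_pmul2l// ltnW.
  rewrite /t [(8 * C)%N]mulnC -mulnA leq_pmul2l//.
  exact: cube_succ_le.
have tQ : (t < Q * (H * h))%N.
  apply: (@leq_trans (Q * h)); last by rewrite leq_mul2l leq_pmull ?orbT.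
  by rewrite /t /Q mulSn /h (expnS m 2) mulnA -[X in (X < _)%N]add0n ltn_add2r.
have big_mu : 2 * C%:R * (H * h)%:R * (S * b)%:R + C%:R * (H * h)%:R <= eps / 2 * mu x.
  have k1 : C%:R * H%:R * S%:R * b%:R <= eps / 16 * m%:R.
    apply: (@le_trans _ _ (C%:R * H%:R * S%:R * (c2 * m%:R))).
      by rewrite ler_wpM2l// !mulr_ge0.
    rewrite /c2 mulrA ler_wpM2r//.
    rewrite (_ : C%:R * H%:R * S%:R * _ = eps / 16)//; field.
    by rewrite !pnatr_eq0 -!lt0n C0 S0.
  have k2 : C%:R * H%:R * S%:R * b%:R * h%:R <= eps / 16 * m%:R * h%:R.
    by rewrite ler_wpM2r// ltW.
  have k3 : 8 * C%:R * H%:R * h%:R <= eps * m%:R * h%:R by rewrite ler_wpM2r// ltW.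
  have k4 : eps / 2 * (m%:R * h%:R / 2) <= eps / 2 * mu x by rewrite ler_wpM2l//; lra.
  rewrite !natrM; nra.
pose lam := kap / m%:R.
have lam0 : 0 <= lam by rewrite divr_ge0// ltW.
have lam2 : lam ^+ 2 <= 2^-1.
  have : lam <= 1 by rewrite ler_pdivrMr ?ltr0n//; nra.
  have : lam <= kap by rewrite ler_pdivrMr ?ltr0n// ler_peMr// ltW.
  nra.
have hB u := law_jump mY Yindep Yshift Ystep Yunit hd hMom t h u lam0 lam2.
have dl1 : expR (- theta) <= 1 by rewrite -expR0 ler_expR oppr_le0.
have hfast := hh0 h (leq_trans mh0 hm).
apply: le_trans (law_early eps01 h0' dH mut tQ big_mu hB dl1 hfast) _.
rewrite [leRHS]mulrDl; apply: lerD.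
- have -> : 2 * lam ^+ 2 * t%:R - lam * (h%:R / d%:R) = - (c3 * m%:R).
    rewrite /lam /c3 /t /kap hR !natrM ?natrX; field.
    by rewrite !pnatr_eq0 -!lt0n C0 hd m0.
  have m30 : (0 < m ^ 3)%N by rewrite expn_gt0 m0.
  have CM : (0 < C * m ^ 3)%N by rewrite muln_gt0 C0.
  have t1 : (t.*2.+1 <= 17 * C * m ^ 3)%N.
    by rewrite /t -!mulnA; exact: double_mul8_le.
  have t2 : (t.+1 <= 17 * C * m ^ 3)%N.
    by apply: leq_trans t1; rewrite ltnS -addnn leq_addr.
  have E0 : 0 <= expR (- (c3 * m%:R)) :> R by exact: expR_ge0.
  have step1 : (t.*2.+1 ^ d)%:R * t.+1%:R <= (17 * C%:R) ^+ d.+1 * m%:R ^+ N :> R.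
    apply: (@le_trans _ _ (((17 * C * m ^ 3) ^ d * (17 * C * m ^ 3))%N%:R)).
      by rewrite -natrM ler_nat leq_mul// leq_exp2r.
    by rewrite -expnSr natrX [(17 * C * m ^ 3)%:R]natrM [(m ^ 3)%:R]natrX exprMn -exprM natrM.
  have step2 : m%:R ^+ N * expR (- (c3 * m%:R)) <=
      (N%:R / (c3 / 2)) ^+ N * expR (- (c3 / 2 * m%:R)).
    have c30' : 0 < c3 / 2 by rewrite divr_gt0.
    have := pow_le_expR c30' (ler0n R m) (_ : (0 < N)%N).
    move=> /(_ isT) pw.
    apply: (@le_trans _ _ ((N%:R / (c3 / 2)) ^+ N * expR (c3 / 2 * m%:R) * expR (- (c3 * m%:R)))).
      by rewrite ler_wpM2r.
    by rewrite -mulrA -expRD (_ : c3 / 2 * m%:R - c3 * m%:R = - (c3 / 2 * m%:R))//; field.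
  have MD : 0 <= Mom * (2 * d)%:R by rewrite mulr_ge0.
  apply: (@le_trans _ _ (Mom * (2 * d)%:R * ((17 * C%:R) ^+ d.+1 * m%:R ^+ N) *
      expR (- (c3 * m%:R)))).
    rewrite (_ : _ * (Mom * _) = Mom * (2 * d)%:R * ((t.*2.+1 ^ d)%:R * t.+1%:R) *
      expR (- (c3 * m%:R))); last by ring.
    by rewrite ler_wpM2r// ler_wpM2l.
  rewrite (_ : Mom * _ * _ * _ = Mom * (2 * d)%:R * (17 * C%:R) ^+ d.+1 *
    (m%:R ^+ N * expR (- (c3 * m%:R)))); last by ring.
  rewrite /A1 -[leRHS]mulrA ler_wpM2l// mulr_ge0// exprn_ge0// mulr_ge0//.
- rewrite -/D0 natrX.
  have -> : (D0%:R : R) ^+ Q = expR (Q%:R * ln D0%:R).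
    by rewrite expRM_natl lnK// posrE ltr0n.
  rewrite -expRM_natl -!expRD ler_expR.
  have Q9 : Q%:R <= 9 * C%:R * m%:R :> R.
    by rewrite -!natrM ler_nat succ_mul8_le// muln_gt0 C0.
  have q1 : Q%:R * ln D0%:R <= 9 * C%:R * m%:R * ln D0%:R :> R by rewrite ler_wpM2r.
  have q2 : theta * c2 = 9 * C%:R * ln D0%:R + 1 by rewrite /theta divfK// gt_eqF.
  have q3 : theta * (c2 * m%:R) <= theta * (b%:R + 1) by rewrite ler_wpM2l// ltW.
  have q4 : theta * (c2 * m%:R) = (9 * C%:R * ln D0%:R + 1) * m%:R by rewrite mulrA q2.
  have q5 : c3 / 2 * m%:R <= m%:R by rewrite ler_piMl.
  nra.
Qed.

End StretchedExponential.

(** * The first moment, the norm and the convergence hypothesis in lattice terms *)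

Lemma tail_sum_le (R : realType) (dm : measure_display) (Om : measurableType dm)
  (P : probability Om R) (X : Om -> nat) n :
  (forall k, measurable [set w | X w = k]) ->
  (\sum_(l < n) P [set w | (l < X w)%N] <= \int[P]_w ((X w)%:R)%:E)%E.
Proof.
move=> mX.
have mX' (Q : nat -> Prop) : measurable [set w | Q (X w)].
  have -> : [set w | Q (X w)] = \bigcup_(k in Q) [set w | X w = k].
    by apply/seteqP; split=> w /=; [exists (X w)|case=> k Qk ->].
  by apply: bigcup_measurable => k _; exact: mX.
have mA l : measurable [set w | (l < X w)%N] by exact: (mX' (fun k => (l < k)%N)).
pose f : Om -> \bar R := fun w => ((X w)%:R)%:E.
have mf : measurable_fun setT f.
  move=> _ B mB; rewrite setTI.
  exact: (mX' (fun k => B (k%:R%:E))).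
have -> : (\sum_(l < n) P [set w | (l < X w)%N] =
    \int[P]_w \sum_(l < n) (\1_[set w | (l < X w)%N] w : R)%:E)%E.
  rewrite ge0_integral_sum//.
  - by apply: eq_bigr => l _; rewrite integral_indic// setIT.
  - by move=> l; apply/measurable_EFinP; exact: measurable_indic.
apply: ge0_le_integral => //.
- by move=> w _; apply: sume_ge0.
- apply: emeasurable_sum => l; apply/measurable_EFinP; exact: measurable_indic.
move=> w _; rewrite sumEFin lee_fin.
have -> : \sum_(l < n) (\1_[set w | (l < X w)%N] w : R) = (\sum_(l < n) (l < X w)%N)%:R.
  rewrite natr_sum; apply: eq_bigr => l _; rewrite indicE.
  by congr (_%:R); congr nat_of_bool; apply/idP/idP; rewrite inE.
rewrite ler_nat.
suff h : (\sum_(l < n) (l < X w) <= minn n (X w))%N by exact: leq_trans h (geq_minr _ _).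
elim: n => [|k IH]; first by rewrite big_ord0.
rewrite big_ord_recr /=; move: IH; rewrite leq_min => /andP[IH1 IH2].
case: (ltnP k (X w)) => h /=; rewrite ?addn1 ?addn0 leq_min.
  by rewrite ltnS IH1 (leq_ltn_trans IH1 h).
by rewrite (leqW IH1) IH2.
Qed.

Section Norm.
Context (R : realType) (d : nat) (mu : 'rV[R]_d -> R) (hmu : is_norm mu).
Let m (x : lat d) := mu (vR R x).

Lemma vRD (x y : lat d) : vR R (x + y) = vR R x + vR R y.
Proof. by rewrite /vR map_mxD. Qed.

Lemma vRN (x : lat d) : vR R (- x) = - vR R x.
Proof. by rewrite /vR map_mxN. Qed.

Lemma norm_lat_ge0 x : 0 <= m x. Proof. by case: hmu => h _ _ _; exact: h. Qed.

Lemma norm_latD x y : m (x + y) <= m x + m y.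
Proof. by rewrite /m vRD; case: hmu => _ _ _; exact. Qed.

Lemma norm_latN x : m (- x) = m x.
Proof. by case: hmu => _ _ hZ _; rewrite /m vRN -scaleN1r hZ normrN1 mul1r. Qed.

Lemma norm_lat_le : exists C, (0 < C)%N /\ forall x, m x <= C%:R * (nrm x)%:R.
Proof.
case: hmu => h0 _ hZ hD.
pose M := \sum_(j < d) mu 'e_j.
exists (Num.truncn M).+1; split=> // x.
have M0 : 0 <= M by apply: sumr_ge0.
apply: (@le_trans _ _ (M * (nrm x)%:R)); last first.
  by rewrite ler_wpM2r// ltW// truncnS_gt.
have step (s : seq 'I_d) : mu (\sum_(j <- s) (vR R x) 0 j *: 'e_j) <=
    \sum_(j <- s) `|(vR R x) 0 j| * mu 'e_j.
  elim: s => [|j s IH].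
    by rewrite !big_nil -(scale0r (0 : 'rV[R]_d)) hZ normr0 mul0r.
  by rewrite !big_cons; apply: le_trans (hD _ _) _; rewrite hZ lerD2l.
rewrite /m {1}(row_sum_delta (vR R x)); apply: le_trans (step _) _.
rewrite /M mulr_suml; apply: ler_sum => j _.
by rewrite mulrC ler_wpM2l// mxE -intr_norm -natr_absz ler_nat nrm_coord.
Qed.

End Norm.

Section Frogs.
Context (R : realType) (d : nat) (dm : measure_display) (Om : measurableType dm)
  (P : probability Om R) (om : lat d -> Om -> nat)
  (S : lat d -> nat -> nat -> Om -> lat d) (mu : lat d -> R).
Local Notation idx := (lat d + (lat d * nat * nat))%type.
Local Notation val := (nat + lat d)%type.
Local Notation cfg := (idx -> val).
Hypothesis hS0 : forall x l w, S x l 0%N w = x.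

Definition converges (w : Om) : Prop :=
  forall e : R, 0 < e -> exists N : R, forall x : lat d, N <= norm1 R x ->
       (`| fpt R om S 0%R x w - (mu x)%:E | <= (e * norm1 R x)%:E)%E.

Lemma converges_fin w e : converges w -> 0 < e -> exists N : nat, forall x : lat d,
  (N <= nrm x)%N -> (0 < nrm x)%N /\ exists r : R, [/\ fpt R om S 0 x w = r%:E,
    mu x - e * (nrm x)%:R <= r & r <= mu x + e * (nrm x)%:R].
Proof.
(* The successor keeps [x] away from the origin, where empty chains would interfere. *)
move=> cw e0; have [N hN] := cw e e0; exists (Num.truncn N).+1 => x Nx.
split; first exact: leq_trans Nx.
have := hN x; rewrite norm1E => /(_ _).
have -> : N <= (nrm x)%:R.
  by apply: ltW; apply: lt_le_trans (truncnS_gt _) _; rewrite ler_nat.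
move=> /(_ isT); case: (fpt R om S 0 x w) => [r||] //= h; exists r; split=> //.
  by move: h; rewrite lee_fin ler_norml => /andP[]; lra.
by move: h; rewrite lee_fin ler_norml => /andP[]; lra.
Qed.

Lemma fpt_reach w x (a : R) : unit_steps (env om S w) -> (fpt R om S 0 x w <= a%:E)%E ->
  exists t, t%:R <= a /\ reach (env om S w) 0 x t.
Proof.
move=> uw /(fpt_chain hS0) [q [qx cq qa]]; exists (ptime q); split=> //.
by exists q; split=> //; exact: chain_slow cq.
Qed.

Lemma reach_fpt w x t : (0 < nrm x)%N -> reach (env om S w) 0 x t ->
  (fpt R om S 0 x w <= (t%:R)%:E)%E.
Proof.
move=> x0 [q [_ qx <- cq]]; apply: (chain_fpt R hS0 qx) => //.
by apply: contraTneq x0 => <-; rewrite nrm0.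
Qed.

Lemma converges_typical w e : converges w -> unit_steps (env om S w) -> 0 < e ->
  exists N : nat, forall x, (N <= nrm x)%N -> typical mu e (env om S w) 0 x.
Proof.
move=> cw uw e0; have [N hN] := converges_fin cw e0; exists N => x /hN [x0 [r [hr r1 r2]]].
rewrite /typical subr0; split.
  have [|t [ta rt]] := @fpt_reach w x (mu x + e * (nrm x)%:R) uw.
    by rewrite hr lee_fin.
  by exists t.
move=> t [tlt /(reach_fpt x0)]; rewrite hr lee_fin; lra.
Qed.

(** Speed at most one forces [T(0,x) >= |x|], and [T] is within [|x| / 2] of [mu] far out. As [mu]
    is deterministic, a single good outcome suffices. *)
Lemma converges_mu w : converges w -> unit_steps (env om S w) ->
  exists N : nat, forall x, (N <= nrm x)%N -> (nrm x)%:R / 2 <= mu x.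
Proof.
move=> cw uw; have h2 : (0 : R) < 2^-1 by rewrite invr_gt0.
have [N hN] := converges_fin cw h2; exists N => x /hN [x0 [r [hr r1 r2]]].
have [|t [tr /reach_nrm]] := @fpt_reach w x r uw; first by rewrite hr.
rewrite subr0 -(ler_nat R); lra.
Qed.

Lemma fpt_early w x (a : R) : (0 < nrm x)%N ->
  (fpt R om S 0 x w <= a%:E)%E <-> early a x (env om S w).
Proof.
move=> x0; split.
  by move=> /(fpt_chain hS0) [q [qx cq qa]]; exists q.
move=> [q [[qx qa] cq]]; apply: (@le_trans _ _ ((ptime q)%:R)%:E); last by rewrite lee_fin.
apply: (chain_fpt R hS0 qx) => //.
by apply: contraTneq x0 => <-; rewrite nrm0.
Qed.

End Frogs.

(** * From the tail estimate to the limit superior *)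

Lemma cube_root n : exists m, (m ^ 3 <= n < m.+1 ^ 3)%N.
Proof.
elim: n => [|n [m /andP[lo hi]]]; first by exists 0%N.
have [h|h] := ltnP n.+1 (m.+1 ^ 3); first by exists m; rewrite h leqW.
exists m.+1; rewrite h; apply: leq_ltn_trans hi _.
by rewrite ltn_exp2r.
Qed.

(** Half of the exponent absorbs [ln B], and [n^(1/3) <= m + 1 <= 2 m] costs another factor two;
    hence [c / 4]. *)
Lemma elog_rate (R : realType) (n m : nat) (p B c : R) : 0 < c -> 0 < B -> (0 < m)%N ->
  (m ^ 3 <= n < m.+1 ^ 3)%N -> 2 * ln B <= c * m%:R ->
  0 <= p <= B * expR (- (c * m%:R)) ->
  (((n%:R `^ 3^-1)^-1)%:E * elog p <= (- (c / 4))%:E)%E.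
Proof.
move=> c0 B0 m0 /andP[lo hi] lB /andP[p0 pB].
have n0 : (0 < n)%N by apply: leq_trans lo; rewrite expn_gt0 m0.
have mR : 1 <= m%:R :> R by rewrite ler1n.
have k0 : 0 < (n%:R `^ 3^-1 : R) by rewrite powR_gt0// ltr0n.
have km : (n%:R `^ 3^-1 : R) <= 2 * m%:R.
  have -> : 2 * m%:R = (((2 * m) ^ 3)%:R : R) `^ 3^-1.
    rewrite natrX -powR_mulrn// -powRrM divff ?pnatr_eq0// powRr1//.
    by rewrite natrM.
  apply: ge0_ler_powR; rewrite ?nnegrE ?invr_ge0// ler_nat.
  apply: leq_trans (ltnW hi) _; rewrite leq_exp2r//; lia.
rewrite /elog; case: eqP => [_|/eqP pn0].
  by rewrite gt0_muleNy ?leNye// lte_fin invr_gt0.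
rewrite -EFinM lee_fin.
have p1 : 0 < p by rewrite lt_def pn0.
have lp : ln p <= - (c * m%:R / 2).
  have : ln p <= ln (B * expR (- (c * m%:R))).
    by rewrite ler_ln// posrE mulr_gt0// expR_gt0.
  rewrite lnM ?posrE ?expR_gt0// expRK; lra.
rewrite mulrC ler_pdivrMr//.
apply: le_trans lp _; rewrite mulNr lerN2.
apply: (@le_trans _ _ (c / 4 * (2 * m%:R))); last by lra.
by rewrite ler_wpM2l// divr_ge0// ltW.
Qed.

Lemma limsup_norm1_le (R : realType) (d : nat) (f : lat d -> \bar R) (N : nat) (b : \bar R) :
  (forall x, (N <= nrm x)%N -> (f x <= b)%E) -> (limsup_norm1 f <= b)%E.
Proof.
move=> h; apply: ereal_inf_le; eexists; first by exists N.
by apply: ge_ereal_sup => _ [x /= + <-]; rewrite norm1E ler_nat; exact: h.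
Qed.

Theorem theorem1p3 (R : realType) (d : nat) (hd : (2 <= d)%N)
  (dm : measure_display) (Om : measurableType dm) (P : probability Om R)
  (om : lat d -> Om -> nat)
  (S : lat d -> nat -> nat -> Om -> lat d)
  (mu : 'rV[R]_d -> R)
  (* omega and the walks are random variables *)
  (hom_meas : forall x n, measurable [set w | om x w = n])
  (hS_meas : forall x l k v, measurable [set w | S x l k w = v])
  (* common law of the omega(x), not concentrated at 0 *)
  (hom_law : forall x n, P [set w | om x w = n] = P [set w | om 0%R w = n])
  (hom_nondeg : (P [set w | om 0%R w = 0%N] < 1)%E)
  (* simple random walks started at x *)
  (hS0 : forall x l w, S x l 0%N w = x)
  (hS_step : forall x l k (v : lat d), norm1 R v = 1 ->
     P [set w | S x l k.+1 w - S x l k w = v] = ((2 * d)%:R^-1)%:E)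
  (* the omega(x) and all walk increments are mutually independent *)
  (hindep : mutually_indep_discrete P
     (fun (i : (lat d + (lat d * nat * nat))%type) (w : Om) =>
        match i with
        | inl x => (inl (om x w) : (nat + lat d)%type)
        | inr (x, l, k) => inr (S x l k.+1 w - S x l k w)
        end))
  (* E[omega(0)] < oo *)
  (hmean : (\int[P]_w ((om 0%R w)%:R)%:E < +oo)%E)
  (* mu is the time constant: a norm on R^d with, a.s. on {omega(0) >= 1},
     (T(0,x) - mu(x)) / ||x||_1 -> 0 as ||x||_1 -> oo *)
  (hmu_norm : is_norm mu)
  (hmu : {ae P, forall w, (1 <= om 0%R w)%N ->
     forall e : R, 0 < e -> exists N : R, forall x : lat d, N <= norm1 R x ->
       (`| fpt R om S 0%R x w - (mu (vR R x))%:E | <= (e * norm1 R x)%:E)%E}) :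
  exists alpha : R, 0 < alpha < 1 /\
    forall eps : R, 0 < eps ->
      (limsup_norm1 (fun x : lat d =>
         ((norm1 R x `^ alpha)^-1)%:E *
         elog (cond_pr P [set w | (1 <= om 0%R w)%N]
                 [set w | fpt R om S 0%R x w <= ((1 - eps) * mu (vR R x))%:E]))
       < 0)%E.
Proof.
have d0 : (0 < d)%N by exact: leq_trans hd.
set Y := env om S.
have mY : measY Y := measY_env hom_meas hS_meas.
have Yi : cyl_indep P Y := env_indep hindep.
have Ys c (A : set (lat d + (lat d * nat * nat) -> nat + lat d)) :
    csig setT A -> law P Y [set eta | A (shift_cfg c eta)] = law P Y A.
  exact: (law_shift hom_meas hS_meas hom_law hS_step d0 hindep).
have Yst x l k ib := law_step (P := P) om hS_step x l k ib.
have Yu x l k := law_step_unit hom_meas hS_meas hS_step d0 x l k.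
pose m x := mu (vR R x).
have [C [C0 mC]] := norm_lat_le hmu_norm.
have m0 := norm_lat_ge0 hmu_norm.
have mD := norm_latD hmu_norm.
have mN := norm_latN hmu_norm.
have sU := @sig_unit_steps d.
have PU : P (Y @^-1` (~` @unit_steps d)) = 0%E.
  by rewrite (lawE mY (sigC sU)) (law_unit_steps mY Yu).
have [Nul [mNul PNul subNul]] := hmu.
pose q0 := fine (P [set w | om 0 w = 0%N]).
have mo0 := hom_meas 0 0%N.
have q0E : P [set w | om 0 w = 0%N] = q0%:E.
  by rewrite fineK//; exact: fin_num_measure.
have q01 : 0 <= q0 < 1 by rewrite fine_ge0//= -lte_fin -q0E.
have mB : measurable [set w | (1 <= om 0%R w)%N].
  rewrite (_ : [set _ | _] = ~` [set w | om 0 w = 0%N]); first exact: measurableC.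
  by apply/seteqP; split=> w /=; case: (om 0 w).
have PB : P [set w | (1 <= om 0%R w)%N] = (1 - q0)%:E.
  rewrite (_ : [set _ | _] = ~` [set w | om 0 w = 0%N]).
    by rewrite probability_setC// q0E.
  by apply/seteqP; split=> w /=; case: (om 0 w).
have good w : ~ Nul w -> (1 <= om 0%R w)%N -> converges om S m w.
  by move=> nw ow; apply: contrapT => h; apply: nw; apply: subNul => /= /(_ ow).
have mbad : measurable (Nul `|` Y @^-1` (~` @unit_steps d)).
  by apply: measurableU => //; apply: measurable_sig mY (sigC sU).
have Pbad : P (Nul `|` Y @^-1` (~` @unit_steps d)) = 0%E.
  have PNul' : P Nul = 0%E := PNul.
  have h : (P (Nul `|` Y @^-1` (~` @unit_steps d)) <= P Nul + P (Y @^-1` (~` @unit_steps d)))%E.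
    by apply: measureU2 => //; exact: measurable_sig mY (sigC sU).
  by apply/eqP; rewrite eq_le measure_ge0 andbT; move: h; rewrite PNul' PU adde0.
(* A good outcome exists: otherwise [omega(0) >= 1] would lie in a null set, although its
   probability is [1 - q0 > 0]. *)
have [N0 mlow] : exists N0 : nat, forall x, (N0 <= nrm x)%N -> (nrm x)%:R / 2 <= m x.
  have [[w [ow nw uw]]|H] := pselect (exists w, [/\ (1 <= om 0%R w)%N, ~ Nul w &
      unit_steps (Y w)]).
    exact: (converges_mu hS0 (good w nw ow) uw).
  exfalso; have : P [set w | (1 <= om 0%R w)%N] = 0%E.
    apply: (subset_measure0 _ mbad _ Pbad) => // w /= ow.
    apply: contrapT => h; apply: H; exists w; split=> //.
      by move=> nw; apply: h; left.
    by apply: contrapT => nu; apply: h; right.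
  by rewrite PB => -[] /eqP; rewrite subr_eq0 => /eqP e; move: q01; rewrite -e ltxx andbF.
have Yvac (F : seq (lat d)) : uniq F ->
    law P Y [set eta | forall p : lat d, p \in F -> cfg_om eta p = 0%N] <= q0 ^+ size F.
  move=> uF; rewrite le_eqVlt; apply/orP; left; apply/eqP.
  pose G : seq (lat d + (lat d * nat * nat)) := map inl F.
  transitivity (law P Y (asg G (fun=> inl 0%N))).
    congr fine; congr (P _); apply/seteqP; split=> w /= h.
      by move=> _ /mapP[p pF ->]; rewrite /Y /= -(h p pF).
    move=> p pF; have := h (inl p) (map_f _ pF).
    by rewrite /cfg_om => ->.
  rewrite (law_asg hindep) ?map_inj_uniq//; last by move=> a b [].
  rewrite big_map (eq_bigr (fun=> q0)); first by rewrite big_const_seq count_predT iter_mulr_1.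
  move=> p _; rewrite /q0 -(hom_law p); congr fine; congr (P _).
  by apply/seteqP; split=> w /= [->].
(* Deviation includes that the origin is occupied, so off the null sets the assumed convergence
   applies and excludes deviation at all radii. *)
have Ydev e : 0 < e -> law P Y (\bigcap_r deviant m e r 0) = 0.
  move=> e0; have sD : csig setT (\bigcap_r deviant m e r 0).
    by apply: sig_bigcap => r; exact: sig_deviant.
  apply: EFin_inj; rewrite -(lawE mY sD).
  apply: (subset_measure0 _ mbad _ Pbad); first exact: measurable_sig mY sD.
  move=> w /= h; apply: contrapT => hb.
  have nw : ~ Nul w by move=> nw; apply: hb; left.
  have uw : unit_steps (Y w) by apply: contrapT => nu; apply: hb; right.
  have [w0 _] := h 0%N Logic.I.
  have [N hN] := converges_typical hS0 (good w nw w0) uw e0.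
  have [_ [x [Nx]]] := h N Logic.I; apply.
  by apply: hN; move: Nx; rewrite subr0.
pose Mom := fine (\int[P]_w ((om 0 w)%:R)%:E).
have intfin : (\int[P]_w ((om 0 w)%:R)%:E)%E = Mom%:E.
  rewrite fineK// ge0_fin_numE//; apply: integral_ge0 => w _; by rewrite lee_fin.
have hMom n : \sum_(l < n) law P Y [set eta | (l < cfg_om eta 0%R)%N] <= Mom.
  rewrite -lee_fin -intfin -sumEFin.
  apply: le_trans (tail_sum_le P n (hom_meas 0)).
  rewrite le_eqVlt; apply/orP; left; apply/eqP; apply: eq_bigr => l _.
  by rewrite -(lawE mY (sig_om_pred (J := setT) (fun k => (l < k)%N) _)).
have H := early_stretched m0 mD mN mC C0 d0 mY Yi Ys Yst Yu q01 Yvac Ydev hMom mlow.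
exists 3^-1; split; first by apply/andP; split; lra.
move=> eps eps0.
(* The estimate needs [eps <= 1]; for larger [eps] the event is contained in the one for 1, because
   [mu] is nonnegative. *)
pose e1 := Num.min eps 1.
have e01 : 0 < e1 <= 1 by rewrite lt_min eps0 ltr01 /= ge_min lexx orbT.
have e1e : e1 <= eps by rewrite ge_min lexx.
have [A [c [M [A0 c0 hA]]]] := H e1 e01.
have p0 : 0 < 1 - q0 by case/andP: q01; lra.
pose L := ln (A / (1 - q0)).
pose m1 := maxn (maxn M 1) (Num.truncn (2 * L / c)).+1.
apply: (@le_lt_trans _ _ (- (c / 4))%:E); last by rewrite lte_fin oppr_lt0 divr_gt0.
apply: (@limsup_norm1_le _ _ _ (m1 ^ 3)) => x xm.
have [k kx] := cube_root (nrm x); have /andP[klo khi] := kx.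
have m1k : (m1 <= k)%N.
  by rewrite -ltnS -(@ltn_exp2r _ _ 3)//; exact: leq_ltn_trans xm khi.
move: (m1k); rewrite !geq_max => /andP[/andP[Mk k1] Lk].
have x0 : (0 < nrm x)%N by apply: leq_trans klo; rewrite expn_gt0 k1.
rewrite norm1E; apply: (@elog_rate _ _ k _ (A / (1 - q0)) c) => //.
- by rewrite divr_gt0.
- have : 2 * L / c < k%:R by apply: lt_le_trans (truncnS_gt _) _; rewrite ler_nat.
  by rewrite ltr_pdivrMr// [k%:R * c]mulrC => /ltW.

have EE : [set w | (fpt R om S 0 x w <= ((1 - eps) * mu (vR R x))%:E)%E] =
    Y @^-1` early ((1 - eps) * m x) x.
  by apply/seteqP; split=> w /=; move/(fpt_early _ hS0 _ _ x0).
have lE : law P Y (early ((1 - eps) * m x) x) <= A * expR (- (c * k%:R)).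
  apply: le_trans (hA k x Mk kx); apply: (law_mono mY); [exact: sig_early|exact: sig_early|].
  move=> eta [p [[px pt] cp]]; exists p; split=> //; split=> //.
  by apply: le_trans pt _; rewrite ler_wpM2r ?m0// lerD2l lerN2.
(* Conditioning costs at most the factor [1 / (1 - q0)], already included in the constant
   [A / (1 - q0)]. *)
rewrite /cond_pr /pr PB EE /=; apply/andP; split.
  by rewrite divr_ge0 ?fine_ge0// ltW.
rewrite mulrAC ler_pM2r ?invr_gt0//; apply: le_trans lE.
have mE : measurable (Y @^-1` early ((1 - eps) * m x) x).
  by apply: (measurable_sig mY (J := setT)); exact: sig_early.
apply: fine_le; rewrite ?fin_num_measure//; first exact: measurableI.
exact: measureIl.
Qed.
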